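(* Let $K$ be a number field of degree $n$ over $\mathbb{Q}$ with ring of integers $\mathcal{O}$, let $p$ be a rational prime, let $1,\xi_2,\dots,\xi_n$ be an integral basis of $\mathcal{O}$, and put $\xi_1=1+p$. For every positive integer $\kappa$, the form $$F_\kappa(w_0)=\prod_{d\mid\kappa}(w_d-w_0)^{\varepsilon_d},$$ which has dimension $g(\kappa)$ with respect to $\xi_1,\dots,\xi_n$, has degree $\kappa\lambda_\kappa$, that is, $$N(F_\kappa(w_0))=p^{L_\kappa}\quad\text{with}\quad L_\kappa=\kappa\lambda_\kappa,$$ where $\lambda_\kappa$ is the number of distinct prime factors of $p$ in $K$ of degree $\kappa$. If no prime factor of $p$ of degree $\kappa$ exists, then $\lambda_\kappa=0$.
   Context: Here $u_1,\dots,u_n$ are indeterminates and $w_h=u_1\xi_1^{p^h}+\cdots+u_n\xi_n^{p^h}$ for $h\ge0$, so $w_d-w_0=\sum_i u_i(\xi_i^{p^d}-\xi_i)$. For $d\mid\kappa$, $\varepsilon_d=\pm1$ according to whether $\kappa/d$ is a product of an even or odd number of distinct primes, and $\varepsilon_d=0$ if $\kappa/d$ has a repeated prime factor (so $\varepsilon_d=\mu(\kappa/d)$ with $\mu$ the Möbius function), and $$g(\kappa)=\sum_{d\mid\kappa}\varepsilon_d\,p^d .$$ The dimension of $F_\kappa(w_0)$ is its degree (degree of numerator minus degree of denominator) as a rational function in the symbols $\xi_1,\dots,\xi_n$, where $w_d-w_0$ has degree $p^d$. As a divisor (in Kronecker's sense), a form corresponds to the ideal generated by its coefficients: if $I_d$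 is the ideal of $\mathcal{O}$ generated by $\xi_i^{p^d}-\xi_i$ ($i=1,\dots,n$), then $F_\kappa(w_0)$ corresponds to the fractional ideal $\prod_{d\mid\kappa}I_d^{\varepsilon_d}$, and $N(F_\kappa(w_0))$ is the norm of this divisor. The degree of the form $F_\kappa(w_0)$ is the exponent $L_\kappa$ of $p$ in the equation $N(F_\kappa(w_0))=p^{L_\kappa}$. The prime factors of $p$ in $K$ are the prime ideals $P$ of $\mathcal{O}$ dividing $p$, and the degree of $P$ is its residual degree $[\mathcal{O}/P:\mathbb{F}_p]$.
   Formalization: The equation N(F_κ(w_0)) = p^{L_κ} is proved up to a rational factor prime to p, i.e. κλ_κ is the exact exponent of p in the norm; literally it fails, e.g. K = Q, p = 2, κ = 1 gives norm 6 rather than 2. *)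

(* Defs.v *)
From HB Require Import structures.
From mathcomp Require Import all_boot all_order all_algebra all_field.
From mathcomp Require Import finmap.
From mathcomp Require Import boolp classical_sets cardinality.
From mathcomp Require Import mpoly.

Set Implicit Arguments.
Unset Strict Implicit.
Unset Printing Implicit Defensive.

Import Order.TTheory GRing.Theory Num.Theory.

Local Open Scope classical_set_scope.
Local Open Scope ring_scope.

(* The Moebius function, for m > 0. *)
Definition moebius (m : nat) : int :=
  if has (fun q => 1 < logn q m)%N (primes m) then 0
  else (-1) ^+ size (primes m).

Definition eps (kappa d : nat) : int := moebius (kappa %/ d).

Definition gdim (p kappa : nat) : int :=
  \sum_(d <- divisors kappa) eps kappa d * (p ^ d)%:Z.

(* The forms are written over an arbitrary integral domain R, so that the
   x i can be either symbols or elements of a number field. *)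
Definition wform (R : idomainType) (n p : nat) (u x : 'I_n -> R) (h : nat) : R :=
  \sum_(i < n) u i * x i ^+ (p ^ h).

Definition Fform (R : idomainType) (n p : nat) (u x : 'I_n -> R)
    (kappa : nat) : {fraction R} :=
  \prod_(d <- divisors kappa)
     FracField.tofrac (wform p u x d - wform p u x 0) ^ eps kappa d.

(* Numerator degree minus denominator degree; on nonzero fractions this does
   not depend on the representative, and size and degree both differ by 1. *)
Definition ratdeg (A : idomainType) (n : nat)
    (f : {fraction {mpoly A[n]}}) : int :=
  (msize (\n_(repr f)))%:Z - (msize (\d_(repr f)))%:Z.

(* F_kappa(w_0) as a rational function in symbols x_1, ..., x_n, with
   coefficients in Z[u_1, ..., u_n]. *)
Definition symbolicF (n p kappa : nat) :
    {fraction {mpoly {mpoly int[n]}[n]}} :=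
  Fform p (fun i : 'I_n => ('X_i : {mpoly int[n]})%:MP) (fun i => 'X_i) kappa.

Definition ringO (K : fieldExtType rat) : set K :=
  [set x | integralOver (intr : int -> K) x].
Arguments ringO : clear implicits.

Definition integral_basis (K : fieldExtType rat) (n : nat) (b : 'I_n -> K) :=
  (forall i, ringO K (b i)) /\
  (forall x, ringO K x ->
     exists! c : {ffun 'I_n -> int}, x = \sum_(i < n) b i *~ c i).

Definition idealM (K : fieldExtType rat) (A B : set K) : set K :=
  [set x | exists (m : nat) (a b : 'I_m -> K),
     [/\ forall i, A (a i), forall i, B (b i) & x = \sum_(i < m) a i * b i]].

Definition idealV (K : fieldExtType rat) (A : set K) : set K :=
  [set x | forall y, A y -> ringO K (x * y)].

Definition idealX (K : fieldExtType rat) (A : set K) (z : int) : set K :=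
  match z with
  | Posz k => iter k (idealM A) (ringO K)
  | Negz k => iter k.+1 (idealM (idealV A)) (ringO K)
  end.

Definition idealgen (K : fieldExtType rat) (A : set K) : set K :=
  idealM (ringO K) A.

Definition content_ideal (K : fieldExtType rat) (n : nat)
    (f : {mpoly K[n]}) : set K :=
  idealgen (range (fun m : 'X_{1..n} => f@_m)).

(* The fractional ideal prod_{d | kappa} I_d ^ eps_d, where the ideal I_d
   generated by the xi_i ^ (p ^ d) - xi_i is the content of w_d - w_0. *)
Definition divisorF (K : fieldExtType rat) (n p : nat) (xi : 'I_n -> K)
    (kappa : nat) : set K :=
  let w := wform p (fun i => 'X_i) (fun i => (xi i)%:MP : {mpoly K[n]}) in
  \big[@idealM K / ringO K]_(d <- divisors kappa)
     idealX (content_ideal (w d - w 0%N)) (eps kappa d).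

(* The index (A : B), for B a subgroup of A; 0 if it is infinite. *)
Definition quo_index (K : fieldExtType rat) (A B : set K) : nat :=
  #|` fset_set [set [set x + y | y in B] | x in A] |.

(* The norm of a fractional ideal J, as the generalized index (O : J); it is
   #|O / J| for J inside O, and (O : a J) / (O : a O) whenever a J lies in O. *)
Definition ideal_norm (K : fieldExtType rat) (J : set K) : rat :=
  (quo_index (ringO K) (ringO K `&` J))%:R / (quo_index J (ringO K `&` J))%:R.

Definition is_ideal (K : fieldExtType rat) (I : set K) :=
  [/\ I `<=` ringO K, I 0, forall x y, I x -> I y -> I (x + y)
    & forall a x, ringO K a -> I x -> I (a * x)].

Definition prime_ideal (K : fieldExtType rat) (P : set K) :=
  [/\ is_ideal P, P <> ringO K
    & forall x y, ringO K x -> ringO K y -> P (x * y) -> P x \/ P y].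

Definition ideal_dvd (K : fieldExtType rat) (P J : set K) :=
  exists2 Q, is_ideal Q & idealM P Q = J.

Definition prime_factor (K : fieldExtType rat) (p : nat) (P : set K) :=
  prime_ideal P /\ ideal_dvd P (idealgen [set p%:R]).

(* [O/P : F_p] = k: some b_1, ..., b_k in O reduce to an F_p-basis of O/P.
   An element of 'F_p acts on O/P through its representative in nat, which is
   legitimate when p is a prime number lying in P. *)
Definition residual_degree (K : fieldExtType rat) (p : nat) (P : set K)
    (k : nat) :=
  exists b : 'I_k -> K, (forall i, ringO K (b i)) /\
    forall x, ringO K x -> exists! c : {ffun 'I_k -> 'F_p},
      P (x - \sum_(i < k) (nat_of_ord (c i))%:R * b i).

Definition prime_factors_of_degree (K : fieldExtType rat) (p k : nat) :
    set (set K) :=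
  [set P | prime_factor p P /\ residual_degree p P k].
Arguments prime_factors_of_degree : clear implicits.

Definition lambda (K : fieldExtType rat) (p k : nat) : nat :=
  #|` fset_set (prime_factors_of_degree K p k) |.
Arguments lambda : clear implicits.

(* The norm of the divisor of F_kappa(w_0) may contain primes other than p: for
   K = Q, p = 2, kappa = 1 the divisor is (6).  Such factors count as units at p, so that
   the equation N = p ^ L is read as N = p ^ L * r with r a p-unit. *)
Definition p_unit (p : nat) (r : rat) : bool :=
  coprime p `|numq r|%N && coprime p `|denq r|%N.

(* Main.v *)
Require Import Defs.
From mathcomp Require Import all_boot all_order all_algebra all_field.
From mathcomp Require Import finmap.
From mathcomp Require Import boolp classical_sets cardinality.
From mathcomp Require Import mpoly.
From mathcomp Require Import ring zify.
Set Implicit Arguments.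
Unset Strict Implicit.
Unset Printing Implicit Defensive.
Import Order.TTheory GRing.Theory Num.Theory.
Local Open Scope classical_set_scope.
Local Open Scope ring_scope.

(** The divisor of F_kappa(w_0) is the product of the I_d ^ eps_d, where I_d is
    the ideal generated by the xi_i ^ (p ^ d) - xi_i. Two facts give its norm.

    First, the norm of I_d is p ^ s_d up to a factor prime to p, where s_d is
    the sum of the residual degrees f_P over the primes P containing p with
    f_P | d (norm_wdiff_content). Indeed, L = I_d + p O is the smallest ideal
    containing p modulo which x ^ (p ^ d) = x for every x: raising to the power
    p ^ d is additive modulo p (frobenius_fixes). A finite ring in which
    x ^ (p ^ d) = x is reduced, so L is the intersection of the primes that
    contain it (radical_mem), and its index is the product of their norms p ^ f_P
    by the Chinese remainder theorem (norm_radical). A prime P over p contains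
    L if and only if x ^ (p ^ d) = x in the field O / P, that is, f_P | d
    (frobenius_fixes_mod_prime). Finally, I_d and L agree at p, because the
    choice xi_1 = 1 + p puts into I_d the element (1 + p) ^ (p ^ d) - (1 + p),
    which is p times an integer prime to p.

    Second, the norm is multiplicative on fractional ideals (has_normM), which
    rests on the invertibility of the nonzero ideals of O (nzideal_invertible).
    The latter comes from the finiteness of the quotients O / m O and from O
    being integrally closed: an x of K all of whose powers have a common
    denominator m is integral, since two of the m x ^ k must be congruent modulo
    m (almost_integral), and every nonzero prime P has some x outside O with x P
    in O (prime_ideal_multiplier).

    The exponent of p is then the sum over d | kappa of eps_d s_d. A prime of
    degree f contributes f times the sum of the eps_d over f | d | kappa, which
    is 1 if f = kappa and 0 otherwise (sum_eps): the total is kappa times the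
    number of primes of degree kappa (sum_degrees). The dimension
    follows from w_d - w_0 having degree p ^ d in the symbols (ratdeg_symbolicF). *)

(** * The ring of integers and products of modules over it *)
Section RingOfIntegers.
Variable K : fieldExtType rat.
Implicit Types (x y : K) (A B C : set K).
Notation O := (ringO K).

Lemma ringO_int (z : int) : O z%:~R.
Proof. exact: (integral_id (intr : int -> K) z). Qed.

Lemma ringO_nat (k : nat) : O k%:R.
Proof. exact: (ringO_int k). Qed.

Lemma ringO0 : O 0. Proof. exact: (ringO_nat 0). Qed.
Lemma ringO1 : O 1. Proof. exact: (ringO_nat 1). Qed.

Lemma ringOD x y : O x -> O y -> O (x + y).
Proof. exact: integral_add. Qed.

Lemma ringON x : O x -> O (- x).
Proof. exact: integral_opp. Qed.

Lemma ringOB x y : O x -> O y -> O (x - y).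
Proof. by move=> ? ?; apply: ringOD => //; apply: ringON. Qed.

Lemma ringOM x y : O x -> O y -> O (x * y).
Proof. exact: integral_mul. Qed.

Lemma ringOX x k : O x -> O (x ^+ k).
Proof.
move=> Ox; elim: k => [|k IHk]; first exact: ringO1.
by rewrite exprS; apply: ringOM.
Qed.

Lemma ringO_sum (I : Type) (s : seq I) (P : pred I) (F : I -> K) :
  (forall i, P i -> O (F i)) -> O (\sum_(i <- s | P i) F i).
Proof.
by move=> OF; elim/big_ind: _ => //; [exact: ringO0 | exact: ringOD].
Qed.

Lemma ringO_prod (I : Type) (s : seq I) (P : pred I) (F : I -> K) :
  (forall i, P i -> O (F i)) -> O (\prod_(i <- s | P i) F i).
Proof.
by move=> OF; elim/big_ind: _ => //; [exact: ringO1 | exact: ringOM].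
Qed.

(** Fractional ideals are handled as O-submodules of K. *)
Definition Omodule A :=
  [/\ A 0, forall x y, A x -> A y -> A (x + y) & forall a x, O a -> A x -> A (a * x)].

Lemma OmoduleN A x : Omodule A -> A x -> A (- x).
Proof.
by case=> _ _ AM Ax; rewrite -mulN1r; apply: AM => //; apply/ringON/ringO1.
Qed.

Lemma OmoduleB A x y : Omodule A -> A x -> A y -> A (x - y).
Proof. by move=> mA Ax /(OmoduleN mA); case: mA => _ AD _; apply: AD. Qed.

Lemma OmoduleMr A a x : Omodule A -> O a -> A x -> A (x * a).
Proof. by case=> _ _ AM Oa Ax; rewrite mulrC; apply: AM. Qed.

Lemma Omodule_sum A (I : Type) (s : seq I) (P : pred I) (F : I -> K) :
  Omodule A -> (forall i, P i -> A (F i)) -> A (\sum_(i <- s | P i) F i).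
Proof. by case=> A0 AD _ AF; elim/big_ind: _. Qed.

Lemma Omodule_ringO : Omodule O.
Proof. by split; [exact: ringO0 | exact: ringOD | exact: ringOM]. Qed.

Lemma Omodule_ideal A : is_ideal A -> Omodule A.
Proof. by case. Qed.

Lemma ideal_ringO : is_ideal O.
Proof. by split; [| exact: ringO0 | exact: ringOD | exact: ringOM]. Qed.

Lemma ideal_full A : is_ideal A -> A 1 -> A = O.
Proof.
move=> [AO _ _ AM] A1; apply/seteqP; split => // x Ox.
by rewrite -[x]mulr1; apply: AM.
Qed.

Lemma mem_idealM A B a b : A a -> B b -> idealM A B (a * b).
Proof.
by move=> Aa Bb; exists 1, (fun=> a), (fun=> b); rewrite big_ord1; split.
Qed.

Lemma idealM0 A B : idealM A B 0.
Proof. by exists 0, (fun=> 0), (fun=> 0); rewrite big_ord0; split => [[]|[]|]. Qed.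

Lemma idealMD A B x y : idealM A B x -> idealM A B y -> idealM A B (x + y).
Proof.
move=> [k [a [b [Aa Bb ->]]]] [l [a' [b' [Aa' Bb' ->]]]].
pose glue (u : 'I_k -> K) (v : 'I_l -> K) (i : 'I_(k + l)) :=
  match fintype.split i with inl j => u j | inr j => v j end.
exists (k + l)%N, (glue a a'), (glue b b'); split.
- by move=> i; rewrite /glue; case: fintype.split.
- by move=> i; rewrite /glue; case: fintype.split.
have splitl i : fintype.split (lshift l i) = inl i := unsplitK (inl i).
have splitr i : fintype.split (rshift k i) = inr i := unsplitK (inr i).
rewrite big_split_ord /=; congr (_ + _); apply: eq_bigr => i _.
  by rewrite /glue splitl.
by rewrite /glue splitr.
Qed.

Lemma idealM_sub A B C :
    C 0 -> (forall x y, C x -> C y -> C (x + y)) ->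
    (forall a b, A a -> B b -> C (a * b)) ->
  idealM A B `<=` C.
Proof.
move=> C0 CD CAB _ [k [a [b [Aa Bb ->]]]].
by elim/big_ind: _ => // i _; apply: CAB.
Qed.

Lemma idealMC A B : idealM A B = idealM B A.
Proof.
by apply/seteqP; split; apply: idealM_sub;
  [exact: idealM0 | exact: idealMD | move=> a b ? ?; rewrite mulrC; exact: mem_idealM
  |exact: idealM0 | exact: idealMD | move=> a b ? ?; rewrite mulrC; exact: mem_idealM].
Qed.

Lemma idealMA_sub A B C : idealM A (idealM B C) `<=` idealM (idealM A B) C.
Proof.
apply: idealM_sub; [exact: idealM0 | exact: idealMD | move=> a y Aa].
apply: (@idealM_sub _ _ (fun y => idealM (idealM A B) C (a * y))).
- by rewrite mulr0; exact: idealM0.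
- by move=> *; rewrite mulrDr; apply: idealMD.
- by move=> b c Bb Cc; rewrite mulrA; do 2?apply: mem_idealM.
Qed.

Lemma idealMA A B C : idealM A (idealM B C) = idealM (idealM A B) C.
Proof.
apply/seteqP; split; first exact: idealMA_sub.
rewrite idealMC (idealMC A) (idealMC A) (idealMC B C).
exact: idealMA_sub.
Qed.

Lemma idealMS A A' B B' :
  A `<=` A' -> B `<=` B' -> idealM A B `<=` idealM A' B'.
Proof.
move=> sA sB; apply: idealM_sub; [exact: idealM0 | exact: idealMD | move=> a b Aa Bb].
by apply: mem_idealM; [apply: sA | apply: sB].
Qed.

Lemma Omodule_idealM A B : Omodule A -> Omodule (idealM A B).
Proof.
move=> [_ _ AM]; split; [exact: idealM0 | exact: idealMD | move=> a x Oa].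
apply: (@idealM_sub _ _ (fun x => idealM A B (a * x))).
- by rewrite mulr0; exact: idealM0.
- by move=> *; rewrite mulrDr; apply: idealMD.
- by move=> b c Bb Cc; rewrite mulrA; apply: mem_idealM => //; apply: AM.
Qed.

Lemma idealM1 A : Omodule A -> idealM O A = A.
Proof.
move=> [A0 AD AM]; apply/seteqP; split; first exact: idealM_sub.
by move=> x Ax; rewrite -[x]mul1r; apply: mem_idealM => //; apply: ringO1.
Qed.

Lemma idealMr1 A : Omodule A -> idealM A O = A.
Proof. by rewrite idealMC; apply: idealM1. Qed.

Lemma idealM_subl A B : is_ideal A -> Omodule B -> idealM A B `<=` B.
Proof.
move=> [AO _ _ _] mB; rewrite -{2}(idealM1 mB); exact: idealMS.
Qed.

Lemma is_idealM A B : is_ideal A -> is_ideal B -> is_ideal (idealM A B).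
Proof.
move=> iA iB; have [M0 MD MM] := Omodule_idealM B (Omodule_ideal iA).
split=> //; have [BO _ _ _] := iB.
exact: subset_trans (idealM_subl iA (Omodule_ideal iB)) BO.
Qed.

Lemma Omodule_idealV A : Omodule (idealV A).
Proof.
split.
- by move=> y _; rewrite mul0r; apply: ringO0.
- by move=> x y Vx Vy z Az; rewrite mulrDl; apply: ringOD; [apply: Vx | apply: Vy].
- by move=> a x Oa Vx z Az; rewrite -mulrA; apply: ringOM => //; apply: Vx.
Qed.

Lemma idealMV_sub A : idealM A (idealV A) `<=` O.
Proof.
apply: idealM_sub; [exact: ringO0 | exact: ringOD | move=> a b Aa Vb].
by rewrite mulrC; apply: Vb.
Qed.

(** With V the set idealV A, V = (B A) V = B (A V) is contained in B. *)
Lemma idealV_unique A B :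
  Omodule B -> idealM A B = O -> B = idealV A.
Proof.
move=> mB AB1; apply/seteqP; split=> [b Bb a Aa|].
  by rewrite -AB1 mulrC; apply: mem_idealM.
rewrite -[X in X `<=` _](idealM1 (Omodule_idealV A)) -AB1 (idealMC A) -idealMA.
rewrite -{2}(idealMr1 mB); apply: idealMS => //; exact: idealMV_sub.
Qed.

End RingOfIntegers.

(** * Indices of subgroups through transversals *)
Section Index.
Variable K : fieldExtType rat.
Implicit Types (x y : K) (A B C : set K).

Definition subgroup B := B 0 /\ forall x y, B x -> B y -> B (x - y).

Lemma subgroupN B x : subgroup B -> B x -> B (- x).
Proof. by case=> B0 BB Bx; rewrite -sub0r; apply: BB. Qed.

Lemma subgroupD B x y : subgroup B -> B x -> B y -> B (x + y).
Proof. by move=> sB Bx By; rewrite -[y]opprK; apply: sB.2 => //; apply: subgroupN. Qed.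

Lemma subgroup_sym B x y : subgroup B -> B (x - y) -> B (y - x).
Proof. by move=> sB /(subgroupN sB); rewrite opprB. Qed.

Lemma subgroup_trans B x y z : subgroup B -> B (x - y) -> B (y - z) -> B (x - z).
Proof. by move=> sB Bx /(subgroupD sB Bx); rewrite addrA subrK. Qed.

Lemma Omodule_subgroup A : Omodule A -> subgroup A.
Proof. by move=> mA; split=> [|x y Ax Ay]; [case: mA | apply: OmoduleB]. Qed.

(** Indices are computed on systems of representatives: those of a tower of
    subgroups multiply, and no quotient type has to be formed. *)
Definition transversal A B (T : finType) (r : T -> K) :=
  (forall t, A (r t)) /\ forall x, A x -> exists! t, B (x - r t).

Definition finite_index A B :=
  exists (k : nat) (r : 'I_k -> K), transversal A B r.

Lemma transversal_inj A B (T : finType) (r : T -> K) x s t :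
  transversal A B r -> A x -> B (x - r s) -> B (x - r t) -> s = t.
Proof. by case=> _ /[apply] -[u [_ uP]] /uP <- /uP <-. Qed.

Lemma transversal_finite_index A B (T : finType) (r : T -> K) :
  transversal A B r -> finite_index A B.
Proof.
move=> [Ar rP]; exists #|T|, (r \o enum_val); split=> [t|x Ax]; first exact: Ar.
have [t [Bt tP]] := rP x Ax; exists (enum_rank t) => /=.
rewrite /unique enum_rankK; split=> // i /tP ->; exact: enum_valK.
Qed.

Lemma quo_index_transversal A B (T : finType) (r : T -> K) :
  subgroup B -> transversal A B r -> quo_index A B = #|T|.
Proof.
move=> sB rP; rewrite /quo_index.
pose coset x := [set x + y | y in B].
have cosetP x y : coset x = coset y <-> B (x - y).
  split=> [exy | Bxy].
    have [z Bz <-] : coset y x by rewrite -exy; exists 0; rewrite ?addr0 //; case: sB.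
    by rewrite addrC addKr.
  apply/seteqP; split=> _ [z Bz <-].
    by exists (x - y + z); [apply: subgroupD | rewrite addrA subrKC].
  exists (y - x + z); last by rewrite addrA subrKC.
  by apply: subgroupD => //; apply: subgroup_sym.
have -> : [set [set x + y | y in B] | x in A] =
          [set` [fset coset (r t) | t in T]%fset].
  apply/seteqP; split=> [_ [x Ax <-] | _ /= /imfsetP[t _ ->]].
    have [t [Bt _]] := rP.2 x Ax.
    by apply/imfsetP; exists t => //; apply/cosetP.
  by exists (r t); first exact: rP.1.
rewrite set_fsetK card_imfset /=; first by rewrite cardE; congr size; apply: eq_enum.
move=> s t /cosetP Bst; apply: (transversal_inj rP (rP.1 s)) => //.
by rewrite subrr; case: sB.
Qed.

Lemma finite_index_quo A B : subgroup B -> finite_index A B ->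
  exists r : 'I_(quo_index A B) -> K, transversal A B r.
Proof.
move=> sB [k [r rP]]; rewrite (quo_index_transversal sB rP) card_ord.
by exists r.
Qed.

(** Among the values of f on A, keep one for each class modulo B. *)
Lemma finite_index_separated A B (T : finType) (f : K -> T) :
    subgroup B -> (forall x y, A x -> A y -> f x = f y -> B (x - y)) ->
  finite_index A B.
Proof.
move=> sB fP.
have /choice[g gP] t : exists x, (exists2 y, A y & f y = t) -> A x /\ f x = t.
  have [[y Ay fy]|no] := pselect (exists2 y, A y & f y = t); last by exists 0.
  by exists y.
pose rep x := [pick t | `[< A (g t) /\ B (x - g t) >]].
have repE x y : B (x - y) -> rep x = rep y.
  move=> Bxy; apply: eq_pick => t; apply/asboolP/asboolP => -[At Bt]; split=> //.
    by apply: subgroup_trans Bt => //; apply: subgroup_sym.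
  exact: subgroup_trans Bt.
have repP x : A x -> exists t, [/\ rep x = Some t, A (g t) & B (x - g t)].
  move=> Ax; rewrite /rep; case: pickP => [t /asboolP[At Bt]|/(_ (f x)) /asboolP []].
    by exists t.
  have [Ag fg] := gP (f x) (ex_intro2 _ _ x Ax erefl).
  by split=> //; apply: fP.
pose T' := {t : T | `[< A (g t) >] && (rep (g t) == Some t)}.
apply: (@transversal_finite_index _ _ T' (fun t => g (val t))); split=> [[t]|x Ax].
  by rewrite /= => /andP[/asboolP].
have [t [et At Bt]] := repP x Ax.
have tP : `[< A (g t) >] && (rep (g t) == Some t).
  by apply/andP; split; [apply/asboolP | rewrite -(repE _ _ Bt) et].
exists (exist _ t tP); split=> //= -[s /= sP] Bs; apply: val_inj => /=.
by case/andP: sP => _ /eqP es; move: et; rewrite (repE _ _ Bs) es => -[].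
Qed.

Lemma finite_indexS A A' B B' :
    subgroup B -> subgroup B' -> A' `<=` A -> B `<=` B' ->
  finite_index A B -> finite_index A' B'.
Proof.
move=> sB sB' AA' BB' [k [r rP]].
have /choice[f fP] x : exists t : 'I_k.+1, A x ->
    exists2 s : 'I_k, val s = val t & B (x - r s).
  have [Ax|nAx] := pselect (A x); last by exists ord0.
  have [s [Bs _]] := rP.2 x Ax; exists (widen_ord (leqnSn k) s) => _.
  by exists s.
apply: (@finite_index_separated _ _ _ f) => // x y /AA' /fP[s es Bs] /AA' /fP[t et Bt] fxy.
have est : s = t by apply: val_inj; rewrite es et fxy.
apply: BB'; apply: subgroup_trans Bs _ => //; rewrite est; exact: subgroup_sym.
Qed.

Lemma quo_index_tower A B C :
    subgroup A -> subgroup B -> subgroup C -> C `<=` B -> B `<=` A ->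
    finite_index A B -> finite_index B C ->
  finite_index A C /\ quo_index A C = (quo_index A B * quo_index B C)%N.
Proof.
move=> sA sB sC CB BA [k [r rP]] [l [s sP]].
have rsP : transversal A C (fun t : 'I_k * 'I_l => r t.1 + s t.2).
  split=> [t|x Ax]; first by apply: subgroupD => //; [exact: rP.1 | apply/BA/sP.1].
  have [t [Bt tP]] := rP.2 x Ax; have [u [Cu uP]] := sP.2 _ Bt.
  exists (t, u); split=> [|[t' u'] /= Cx]; first by rewrite /= opprD addrA.
  have et : t = t'.
    apply: tP; move/CB: (Cx) => /(subgroupD sB)/(_ (sP.1 u')).
    by rewrite opprD addrA subrK.
  by rewrite et; congr (_, _); apply: uP; rewrite et -addrA -opprD.
split; first exact: transversal_finite_index rsP.
rewrite (quo_index_transversal sC rsP) (quo_index_transversal sB rP).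
by rewrite (quo_index_transversal sC sP) card_prod.
Qed.

(** Here f induces an isomorphism from A / B onto A' / B', so it carries a
    transversal to a transversal. *)
Lemma quo_index_iso A B A' B' (f : K -> K) :
    subgroup B -> subgroup B' ->
    (forall x, A x -> A' (f x)) ->
    (forall x y, A x -> A y -> B' (f x - f y) <-> B (x - y)) ->
    (forall y, A' y -> exists2 x, A x & B' (y - f x)) ->
    finite_index A B ->
  finite_index A' B' /\ quo_index A' B' = quo_index A B.
Proof.
move=> sB sB' fA fB fsurj [k [r rP]].
have frP : transversal A' B' (f \o r).
  split=> [t|y Ay] /=; first exact/fA/rP.1.
  have [x Ax Bx] := fsurj y Ay; have [t [Bt tP]] := rP.2 x Ax; exists t.
  split=> [|s Bs].
    by apply: subgroup_trans Bx _ => //; apply/fB => //; apply: rP.1.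
  apply: tP; apply/fB => //; first exact: rP.1.
  by apply: subgroup_trans Bs => //; apply: subgroup_sym.
split; first exact: transversal_finite_index frP.
by rewrite (quo_index_transversal sB rP) (quo_index_transversal sB' frP).
Qed.

Lemma quo_index_gt0 A B : subgroup A -> subgroup B -> finite_index A B ->
  (0 < quo_index A B)%N.
Proof.
move=> sA sB /(finite_index_quo sB)[r rP].
by have [t _] := rP.2 0 sA.1; apply: leq_ltn_trans (ltn_ord t).
Qed.

Lemma quo_index_gt1 A B x : subgroup A -> subgroup B -> finite_index A B ->
  A x -> ~ B x -> (1 < quo_index A B)%N.
Proof.
move=> sA sB /(finite_index_quo sB)[r rP] Ax nBx; rewrite ltnNge; apply/negP => le1.
have [t [Bt _]] := rP.2 x Ax; have [s [Bs _]] := rP.2 0 sA.1.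
have est : s = t.
  have ord_eq0 (i : 'I_(quo_index A B)) : i = 0 :> nat.
    by apply/eqP; have := leq_trans (ltn_ord i) le1; rewrite ltnS leqn0.
  by apply/val_inj; rewrite /= !ord_eq0.
apply: nBx; rewrite -(subr0 x); apply: subgroup_trans Bt _ => //; rewrite -est.
exact: subgroup_sym.
Qed.

Lemma quo_index_id A : subgroup A -> finite_index A A /\ quo_index A A = 1%N.
Proof.
move=> sA; have rP : transversal A A (fun _ : 'I_1 => 0 : K).
  split=> [_|x Ax]; first exact: sA.1.
  by exists ord0; rewrite /unique subr0; split=> // t _; rewrite [t]ord1.
split; first exact: transversal_finite_index rP.
by rewrite (quo_index_transversal sA rP) card_ord.
Qed.

End Index.

(** * Prime ideals and invertibility of ideals *)
Section Dedekind.
Variable K : fieldExtType rat.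
Implicit Types (x y : K) (A B C I P : set K).
Notation O := (ringO K).

(** The principal ideal m O. *)
Definition multiples (m : nat) : set K := [set m%:R * y | y in O].

(** Every nonzero ideal of O contains a positive integer m; it then contains
    m O, which bounds its index. *)
Definition nzideal I := is_ideal I /\ exists2 m : nat, (0 < m)%N & I m%:R.

Lemma natrK_eq0 (m : nat) : (m%:R == 0 :> K) = (m == 0)%N.
Proof. by rewrite -(rmorph_nat (in_alg K)) fmorph_eq0 pnatr_eq0. Qed.

Lemma ideal_multiples m : is_ideal (multiples m).
Proof.
split=> [_ [y Oy <-]||_ _ [x Ox <-] [y Oy <-]|a _ Oa [x Ox <-]].
- by apply: ringOM => //; apply: ringO_nat.
- by exists 0; rewrite ?mulr0 //; apply: ringO0.
- by exists (x + y); rewrite ?mulrDr //; apply: ringOD.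
- by exists (a * x); [apply: ringOM | rewrite mulrCA].
Qed.

Lemma multiples_self m : multiples m m%:R.
Proof. by exists 1; rewrite ?mulr1 //; apply: ringO1. Qed.

Lemma nzideal_multiples m : (0 < m)%N -> nzideal (multiples m).
Proof. by split; [exact: ideal_multiples | exists m => //; exact: multiples_self]. Qed.

Lemma multiples_sub I m : is_ideal I -> I m%:R -> multiples m `<=` I.
Proof. by case=> _ _ _ IM Im _ [y Oy <-]; rewrite mulrC; apply: IM. Qed.

Lemma multiplesK m x : (0 < m)%N -> multiples m (m%:R * x) -> O x.
Proof.
rewrite lt0n -natrK_eq0 => m0 [y Oy exy].
by rewrite -(mulfI m0 exy).
Qed.

Hypothesis finO : forall m : nat, (0 < m)%N -> finite_index O (multiples m).

Lemma nzideal_finite_index I : nzideal I -> finite_index O I.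
Proof.
move=> [iI [m m0 Im]]; apply: finite_indexS (finO m0) => //.
- exact/Omodule_subgroup/Omodule_ideal/ideal_multiples.
- exact/Omodule_subgroup/Omodule_ideal.
- exact: multiples_sub.
Qed.

Lemma pigeonhole I (u : nat -> K) : finite_index O I -> Omodule I ->
  (forall k, O (u k)) -> exists i e, I (u (i + e.+1)%N - u i).
Proof.
move=> [k [r rP]] mI Ou.
have /choice[f fP] i : exists t : 'I_k, I (u i - r t).
  by have [t [It _]] := rP.2 _ (Ou i); exists t.
have : ~~ injectiveb (fun i : 'I_k.+1 => f i).
  by apply/injectiveP => /leq_card; rewrite !card_ord ltnn.
move=> /injectivePn[i [j neq_ij fij]].
wlog lt_ij : i j neq_ij fij / (i < j)%N.
  move=> wl; case: (ltngtP i j) => [|lt_ji|/val_inj eij]; first exact: wl.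
    by apply: (wl j i) => //; rewrite eq_sym.
  by rewrite eij eqxx in neq_ij.
exists i, (j - i).-1; rewrite prednK ?subn_gt0 // subnKC ?(ltnW lt_ij) //.
apply: subgroup_trans (fP j) _; first exact: Omodule_subgroup.
by apply: subgroup_sym; [exact: Omodule_subgroup | rewrite -fij].
Qed.

(** Two of the m x ^ k are congruent modulo m O, say those of exponents i < j;
    then x is a root of a monic polynomial X ^ j - X ^ i - y with y in O. *)
Lemma almost_integral m x :
  (0 < m)%N -> (forall k, O (m%:R * x ^+ k)) -> O x.
Proof.
move=> m0 Ox; have mM := Omodule_ideal (ideal_multiples m).
have [i [e]] := pigeonhole (finO m0) mM Ox.
rewrite -mulrBr => /(multiplesK m0).
set y := _ - _ => Oy.
pose q : {poly K} := 'X^(i + e.+1) - ('X^i + y%:P).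
have size_low : (size ('X^i + y%:P : {poly K})%R < size ('X^(i + e.+1) : {poly K})%R)%N.
  rewrite size_polyXn ltnS (leq_trans (size_polyD _ _)) // geq_max size_polyXn.
  by rewrite (leq_trans (size_polyC_leq1 _)) addnS // ltnS leq_addr.
apply: (@integral_root_monic _ _ (intr : int -> K) x q).
- by rewrite monicE lead_coefDl ?size_polyN // lead_coefXn.
- by rewrite rootE /q !(hornerD, hornerN, hornerXn, hornerC) opprD addrA subrr.
apply/integral_poly => k; rewrite !coefE.
apply: ringOB; first exact: ringO_nat.
by apply: ringOD; [exact: ringO_nat | case: eqP => // _; apply: ringO0].
Qed.

(** As O / I is finite, two powers of x are congruent modulo I. *)
Lemma nzideal_powers I x : nzideal I -> O x ->
  exists i e, I (x ^+ i * (1 - x ^+ e.+1)).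
Proof.
move=> nI Ox; have mI := Omodule_ideal nI.1.
have [i [e Iie]] := pigeonhole (nzideal_finite_index nI) mI (fun k => ringOX k Ox).
by exists i, e; have := OmoduleN mI Iie; rewrite opprB exprD mulrBr mulr1.
Qed.

Lemma prime_ideal1 P : prime_ideal P -> ~ P 1.
Proof. by case=> iP nP _ /(ideal_full iP). Qed.

Lemma prime_idealX P x k : prime_ideal P -> O x -> P (x ^+ k) -> P x.
Proof.
move=> pP Ox; elim: k => [/(prime_ideal1 pP)//|k IHk]; rewrite exprS.
by case: pP => _ _ pP /pP[] //; apply: ringOX.
Qed.

(** A finite domain is a field. *)
Lemma prime_ideal_inverse P x : prime_ideal P -> nzideal P -> O x -> ~ P x ->
  exists2 y, O y & P (1 - x * y).
Proof.
move=> pP nP Ox nPx; have [i [e]] := nzideal_powers nP Ox.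
have [_ _ pP2] := pP; case/pP2; first exact: ringOX.
- by apply: ringOB; [exact: ringO1 | exact: ringOX].
- by move/(prime_idealX pP Ox).
by rewrite exprS => Pxe; exists (x ^+ e) => //; apply: ringOX.
Qed.

(** If x y is in I while x and y are not, then I + x O is a strictly larger
    ideal, still proper since 1 = i + x w would give y in I; its index is
    smaller. *)
Lemma exists_prime I : nzideal I -> ~ I 1 -> exists2 P, prime_ideal P & I `<=` P.
Proof.
have [k] := ubnP (quo_index O I); elim: k I => // k IHk I ltk nI nI1.
have [iI [m m0 Im]] := nI; have mI := Omodule_ideal iI.
have [[x [y [Ox Oy nIx nIy Ixy]]]|noxy] :=
  pselect (exists x y, [/\ O x, O y, ~ I x, ~ I y & I (x * y)]); last first.
  exists I => //; split=> // [IO|x y Ox Oy Ixy].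
    by apply: nI1; rewrite IO; apply: ringO1.
  apply: contrapT => /not_orP[nIx nIy].
  by apply: noxy; exists x, y.
pose J := [set z | exists2 w, O w & I (z - x * w)].
have IJ : I `<=` J by move=> z Iz; exists 0; [apply: ringO0 | rewrite mulr0 subr0].
have Jx : J x by exists 1; [apply: ringO1 | rewrite mulr1 subrr; case: iI].
have iJ : is_ideal J.
  have [IO I0 ID IM] := iI; split.
  - move=> z [w Ow /IO Ozw]; rewrite -(subrK (x * w) z).
    by apply: ringOD => //; apply: ringOM.
  - exact: IJ.
  - move=> z z' [w Ow Iw] [w' Ow' Iw']; exists (w + w'); first exact: ringOD.
    by rewrite mulrDr opprD addrACA; apply: ID.
  - move=> a z Oa [w Ow Iw]; exists (a * w); first exact: ringOM.
    by rewrite mulrCA -mulrBr; apply: IM.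
have nJ : nzideal J by split=> //; exists m => //; apply: IJ.
have nJ1 : ~ J 1.
  move=> [w Ow Iw]; apply: nIy; have := OmoduleMr mI Oy Iw.
  rewrite mulrBl mul1r mulrAC mulrC => Iyw; case: iI => _ _ ID IM.
  rewrite -(subrK (w * (x * y)) y); apply: ID; last exact: IM.
  by move: Iyw; rewrite mulrC (mulrC _ w).
have mJ := Omodule_ideal iJ.
have [sO sI sJ] := And3 (Omodule_subgroup (Omodule_ringO K)) (Omodule_subgroup mI)
  (Omodule_subgroup mJ).
have finI := nzideal_finite_index nI; have finJ := nzideal_finite_index nJ.
have finJI : finite_index J I by apply: finite_indexS finI => //; case: iJ.
have [||_ eI] := quo_index_tower sO sJ sI _ _ finJ finJI => //; first by case: iJ.
have [|P pP JP] := IHk J _ nJ nJ1; last by exists P => //; exact: subset_trans JP.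
apply: leq_trans (_ : quo_index O I <= k)%N => //.
by rewrite eI ltn_Pmulr ?quo_index_gt0 // (quo_index_gt1 sJ sI finJI Jx).
Qed.

(** For a positive integer m in P, the annihilator of P in O / m O is nonzero:
    an element c whose annihilator lies in P is multiplied, for each of the
    finitely many classes x of P in turn, by a power of x and an element
    outside P so as to kill x, the annihilator of the result still lying in P.
    Such a c gives c / m, which is not in O but multiplies P into O. *)
Lemma prime_ideal_multiplier P : prime_ideal P -> nzideal P ->
  exists2 x, ~ O x & forall y, P y -> O (x * y).
Proof.
move=> pP [iP [m m0 Pm]]; have [PO _ _ PM] := iP; have mP := Omodule_ideal iP.
set M := multiples m; have nM : nzideal M by apply: nzideal_multiples.
have mM : Omodule M := Omodule_ideal nM.1.
have MP : M `<=` P by apply: multiples_sub.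
have annP (s : seq K) : {in s, forall x, P x} -> exists c,
    [/\ O c, forall z, O z -> M (c * z) -> P z & {in s, forall x, M (c * x)}].
  elim: s => [_|x s IHs Ps].
    by exists 1; split=> [|z Oz|//]; [exact: ringO1 | rewrite mul1r; exact: MP].
  have [c [Oc cP cs]] : exists c,
      [/\ O c, forall z, O z -> M (c * z) -> P z & {in s, forall x, M (c * x)}].
    by apply: IHs => y ys; apply: Ps; rewrite inE ys orbT.
  have Px : P x by apply: Ps; rewrite mem_head.
  have Ox := PO _ Px.
  pose killed j := `[< exists z, [/\ O z, ~ P z & M (c * x ^+ j * z)] >].
  have ex_killed : exists j, killed j.
    have [i [e Mie]] := nzideal_powers nM Ox; exists i; apply/asboolP.
    exists (1 - x ^+ e.+1); split.
    - by apply: ringOB; [exact: ringO1 | exact: ringOX].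
    - move=> P1x; apply: (prime_ideal1 pP); rewrite -(subrK (x ^+ e.+1) 1).
      case: mP => _ PD _; apply: PD => //; rewrite exprSr; apply: PM => //.
      exact: ringOX.
    - by rewrite -mulrA; case: mM => _ _; apply.
  (* By minimality of j, an element that kills c * x ^+ j modulo m lies in P. *)
  case: (ex_minnP ex_killed) => -[|j] /asboolP[z [Oz nPz Mz]] jmin.
    by case: nPz; apply: cP => //; rewrite expr0 mulr1 in Mz.
  exists (c * x ^+ j * z); split.
  - by do 2![apply: ringOM => //]; apply: ringOX.
  - move=> w Ow; rewrite -mulrA => Mzw.
    have Pzw : P (z * w).
      apply: contrapT => nPzw; suff /jmin : killed j by rewrite ltnn.
      by apply/asboolP; exists (z * w); split=> //; apply: ringOM.
    by have [_ _ pP2] := pP; case/pP2: Pzw.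
  - move=> y; rewrite inE => /predU1P[->|ys].
      by rewrite (_ : _ * x = c * x ^+ j.+1 * z) // exprS; ring.
    rewrite (_ : _ * y = (x ^+ j * z) * (c * y)); last by ring.
    by case: mM => _ _ MM; apply: MM; [apply: ringOM => //; apply: ringOX | apply: cs].
have [k [r rP]] := finO m0.
have [|c [Oc cP cr]] := annP [seq r t | t <- enum 'I_k & `[< P (r t) >]].
  by move=> _ /mapP[t + ->]; rewrite mem_filter => /andP[/asboolP].
have m0' : m%:R != 0 :> K by rewrite natrK_eq0 -lt0n.
exists (c / m%:R) => [Ocm|y Py].
  apply: (prime_ideal1 pP); apply: cP; first exact: ringO1.
  by exists (c / m%:R); rewrite // mulr1 mulrC divfK.
have [t [Mt _]] := rP.2 _ (PO _ Py); have Pt : P (r t).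
  by rewrite -[r t](subKr y); apply: OmoduleB => //; apply: MP.
apply: (multiplesK m0); rewrite (_ : _ * _ = c * (y - r t) + c * r t).
  case: (mM) => _ MD MM; apply: MD; first exact: MM.
  by apply: cr; apply/map_f; rewrite mem_filter mem_enum andbT; apply/asboolP.
by rewrite -mulrDr subrK; field.
Qed.

(** If I * I ^ -1 were proper, it would lie in a prime P; an x outside O with
    x P in O would satisfy x I ^ -1 in I ^ -1, so that all powers of x have a
    common denominator in I, and x would be integral. *)
Lemma nzideal_invertible I : nzideal I -> idealM I (idealV I) = O.
Proof.
move=> nI; have [iI [m m0 Im]] := nI; have [IO I0 ID IM] := iI.
pose C := idealM I (idealV I).
have mV : Omodule (idealV I) := Omodule_idealV I.
have V1 : idealV I 1 by move=> y /IO; rewrite mul1r.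
have IC : I `<=` C by move=> x Ix; rewrite -[x]mulr1; apply: mem_idealM.
have iC : is_ideal C.
  have [C0 CD CM] := Omodule_idealM (idealV I) (Omodule_ideal iI).
  by split=> //; apply: idealMV_sub.
have nC : nzideal C by split=> //; exists m => //; apply: IC.
have [/(ideal_full iC)//|nC1] := pselect (C 1).
have [P pP CP] := exists_prime nC nC1.
have nP : nzideal P by split; [case: pP | exists m => //; apply/CP/IC].
have [x nOx xP] := prime_ideal_multiplier pP nP.
have xV y : idealV I y -> idealV I (x * y).
  move=> Vy z Iz; rewrite -mulrA; apply: xP; apply: CP.
  by rewrite mulrC; apply: mem_idealM.
case: nOx; apply: (almost_integral m0) => k.
suff Vxk : idealV I (x ^+ k) by rewrite mulrC; apply: Vxk.
by elim: k => [|k IHk]; rewrite ?expr0 // exprS; apply: xV.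
Qed.

End Dedekind.

(** * The norm of fractional ideals *)
(** Coordinates in an integral basis, reduced modulo m. *)
Lemma transversal_multiples (K : fieldExtType rat) (n : nat) (b : 'I_n -> K) (m : nat) :
    integral_basis b -> (0 < m)%N ->
  transversal (ringO K) (@multiples K m)
    (fun c : {ffun 'I_n -> 'I_m} => \sum_(i < n) (c i)%:R * b i).
Proof.
move=> [Ob bP]; case: m => // m' _; set m := m'.+1.
have mulzE (x : K) (z : int) : x *~ (z * m) = m%:R * (x *~ z).
  by rewrite mulrzA -pmulrn mulr_natl.
split=> [c|x Ox].
  by apply: ringO_sum => i _; apply: ringOM => //; apply: ringO_nat.
have [c [-> cP]] := bP x Ox.
have lt_mod (z : int) : (`|(z %% m)%Z| < m)%N.
  by rewrite -ltz_nat gez0_abs ?modz_ge0 // ltz_mod.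
pose cm : {ffun 'I_n -> 'I_m} := [ffun i => Ordinal (lt_mod (c i))].
have cmE i : (cm i : nat) = (c i %% m)%Z :> int.
  by rewrite ffunE /= gez0_abs // modz_ge0.
exists cm; split=> [|c' [y Oy eq_y]].
  rewrite -sumrB; apply: Omodule_sum => [|i _]; first exact/Omodule_ideal/ideal_multiples.
  exists (b i *~ (c i %/ m)%Z).
    by rewrite -mulrzl; apply: ringOM => //; apply: ringO_int.
  rewrite -mulzE mulr_natl pmulrn cmE -mulrzBr; congr (_ *~ _).
  by rewrite {2}(divz_eq (c i) m) addrK.
have [z [ez _]] := bP y Oy.
have /cP eqc : \sum_(i < n) b i *~ c i = \sum_(i < n) b i *~ [ffun i => (z i * m + c' i)%R] i.
  apply/eqP; rewrite -subr_eq0; apply/eqP.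
  rewrite -[X in X - _](subrK (\sum_(i < n) (c' i)%:R * b i)) -eq_y ez mulr_sumr.
  rewrite -big_split -sumrB big1 // => i _ /=.
  by rewrite ffunE mulrzDr mulzE !mulr_natl -pmulrn subrr.
apply/ffunP => i; apply/val_inj/eqP; rewrite -eqz_nat; apply/eqP.
by rewrite cmE eqc ffunE modzMDl modz_small // ltz_nat ltn_ord.
Qed.

Lemma finite_index_multiples (K : fieldExtType rat) (n : nat) (b : 'I_n -> K) :
    integral_basis b ->
  forall m : nat, (0 < m)%N -> finite_index (ringO K) (@multiples K m).
Proof.
by move=> hb m m0; apply: transversal_finite_index (transversal_multiples hb m0).
Qed.

Lemma quo_index_multiples (K : fieldExtType rat) (n : nat) (b : 'I_n -> K) (m : nat) :
    integral_basis b -> (0 < m)%N ->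
  quo_index (ringO K) (@multiples K m) = (m ^ n)%N.
Proof.
move=> hb m0; rewrite (quo_index_transversal _ (transversal_multiples hb m0)).
  by rewrite card_ffun !card_ord.
exact/Omodule_subgroup/Omodule_ideal/ideal_multiples.
Qed.

Section Norm.
Variable K : fieldExtType rat.
Implicit Types (x y : K) (A B C I J P : set K).
Notation O := (ringO K).
Notation N := (quo_index O).
Hypothesis finO : forall m : nat, (0 < m)%N -> finite_index O (@multiples K m).

Definition invertible A := Omodule A /\ idealM A (idealV A) = O.

Lemma invertible_of A B : Omodule A -> Omodule B -> idealM A B = O -> invertible A.
Proof. by move=> mA mB AB1; split=> //; rewrite -(idealV_unique mB AB1). Qed.

Lemma idealMACA A B C D :
  idealM (idealM A B) (idealM C D) = idealM (idealM A C) (idealM B D).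
Proof. by rewrite !idealMA -(idealMA A) (idealMC B) (idealMA A). Qed.

Lemma invertibleM A B : invertible A -> invertible B ->
  invertible (idealM A B) /\ idealV (idealM A B) = idealM (idealV A) (idealV B).
Proof.
move=> [mA AV] [mB BV].
have mVV := Omodule_idealM (idealV B) (Omodule_idealV A).
have mAB := Omodule_idealM B mA.
have ABV : idealM (idealM A B) (idealM (idealV A) (idealV B)) = O.
  by rewrite idealMACA AV BV idealM1 //; apply: Omodule_ringO.
by split; [exact: invertible_of ABV | rewrite -(idealV_unique mVV ABV)].
Qed.

Lemma invertibleV A : invertible A -> invertible (idealV A).
Proof.
move=> [mA AV]; apply: (@invertible_of _ A) => //; first exact: Omodule_idealV.
by rewrite idealMC.
Qed.

Lemma nzideal_invertibleW I : nzideal I -> invertible I.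
Proof.
by move=> nI; split; [exact/Omodule_ideal/nI.1 | exact: nzideal_invertible].
Qed.

Lemma idealM_cancel A B C : invertible A -> Omodule B -> Omodule C ->
  idealM A B = idealM A C -> B = C.
Proof.
move=> [_ AV] mB mC /(congr1 (idealM (idealV A))).
by rewrite !idealMA (idealMC _ A) AV !idealM1.
Qed.

Lemma nzidealM A B : nzideal A -> nzideal B -> nzideal (idealM A B).
Proof.
move=> [iA [k k0 Ak]] [iB [l l0 Bl]]; split; first exact: is_idealM.
by exists (k * l)%N; rewrite ?muln_gt0 ?k0 // natrM; apply: mem_idealM.
Qed.

Lemma nzideal_ringO : nzideal O.
Proof. by split; [exact: ideal_ringO | exists 1; [|exact: ringO1]]. Qed.

(** If a is in A but not in A P, multiplication by a induces an isomorphism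
    from O / P onto A / A P. *)
Lemma quo_index_mul_prime A P : invertible A -> prime_ideal P -> nzideal P ->
  finite_index A (idealM A P) /\ quo_index A (idealM A P) = N P.
Proof.
move=> iA pP nP; have [mA AV] := iA; have mP := Omodule_ideal nP.1.
have mAP := Omodule_idealM P mA; have [A0 AD AM] := mA; have [PO P0 PD PM] := nP.1.
have APA : idealM A P `<=` A by rewrite idealMC; apply: idealM_subl => //; case: nP.
have [a Aa nAPa] : exists2 a, A a & ~ idealM A P a.
  apply: contrapT => noa; case: pP => _ nPO _; apply: nPO.
  apply: (idealM_cancel iA) => //; first exact: Omodule_ringO.
  rewrite (idealMr1 mA); apply/seteqP; split=> // x Ax.
  by apply: contrapT => nAPx; apply: noa; exists x.
have AVO x c : A x -> idealV A c -> O (x * c) by move=> Ax Vc; rewrite mulrC; apply: Vc.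
have [c Vc nPac] : exists2 c, idealV A c & ~ P (a * c).
  apply: contrapT => noc; apply: nAPa.
  have aVP v : idealV A v -> P (a * v).
    by move=> Vv; apply: contrapT => nP'; apply: noc; exists v.
  have := ringO1 K; rewrite -AV => A1; rewrite -[a]mulr1.
  move: A1; apply: (@idealM_sub _ _ _ (fun z => idealM A P (a * z))).
  - by rewrite mulr0; apply: idealM0.
  - by move=> u v; rewrite mulrDr; apply: idealMD.
  - by move=> u v Au Vv; rewrite mulrCA; apply: mem_idealM => //; apply: aVP.
have [w Ow Pw] := prime_ideal_inverse finO pP nP (AVO _ _ Aa Vc) nPac.
have sP := Omodule_subgroup mP; have sAP := Omodule_subgroup mAP.
apply: (quo_index_iso (f := fun x => a * x)) => //.
- by move=> x Ox; apply: OmoduleMr.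
- move=> x y Ox Oy; rewrite -mulrBr; split=> [APa|Pxy]; last exact: mem_idealM.
  apply: contrapT => nPxy; apply: nAPa.
  have [z Oz Pz] := prime_ideal_inverse finO pP nP (ringOB Ox Oy) nPxy.
  rewrite -(subrK (a * (x - y) * z) a); case: (mAP) => _ APD _; apply: APD.
    by rewrite -mulrA -{1}[a]mulr1 -mulrBr; apply: mem_idealM.
  exact: OmoduleMr.
- move=> y Ay; exists (c * w * y).
    by rewrite mulrAC mulrC; apply: ringOM => //; rewrite mulrC; apply: AVO.
  rewrite (_ : _ - _ = y * (1 - a * c * w)); last by ring.
  exact: mem_idealM.
exact: nzideal_finite_index.
Qed.

(** By induction on the index of B: if a prime P contains B, then B = P C with
    C = P ^ -1 B of smaller index, and A, A P, A P C form a tower. *)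
Lemma quo_index_mul A B : invertible A -> nzideal B ->
  finite_index A (idealM A B) /\ quo_index A (idealM A B) = N B.
Proof.
have [k] := ubnP (N B); elim: k A B => // k IHk A B ltk iA nB.
have [mA AV] := iA; have mB := Omodule_ideal nB.1.
have sO := Omodule_subgroup (Omodule_ringO K); have sA := Omodule_subgroup mA.
have [B1|nB1] := pselect (B 1).
  rewrite (ideal_full nB.1 B1) idealMr1 // !(quo_index_id _).2 //; split=> //.
  exact: (quo_index_id _).1.
have [P pP BP] := exists_prime finO nB nB1.
have nP : nzideal P by split; [case: pP | case: nB => _ [m m0 /BP]; exists m].
have iP := nzideal_invertibleW nP; have [mP PV] := iP.
pose C := idealM (idealV P) B.
have mC : Omodule C by apply/Omodule_idealM/Omodule_idealV.
have PC : idealM P C = B by rewrite idealMA PV idealM1.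
have BC : B `<=` C.
  move=> x Bx; rewrite -[x]mul1r; apply: mem_idealM => // y Py.
  by rewrite mul1r; case: nP => -[PO _ _ _] _; apply: PO.
have iC : is_ideal C.
  split; try by case: mC.
  by rewrite -PV (idealMC P); apply: idealMS.
have nC : nzideal C by split=> //; case: nB => _ [m m0 /BC]; exists m.
have sB := Omodule_subgroup mB; have sC := Omodule_subgroup mC; have sP := Omodule_subgroup mP.
have CO : C `<=` O by case: iC.
have finC := nzideal_finite_index finO nC; have finP := nzideal_finite_index finO nP.
have finCB : finite_index C B.
  by apply: finite_indexS (nzideal_finite_index finO nB).
have [_ eB] := quo_index_tower sO sC sB BC CO finC finCB.
have ltC : (N C < k)%N.
  apply: leq_trans (_ : N B <= k)%N => //; rewrite eB ltn_Pmulr ?quo_index_gt0 //.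
  have [x Cx nBx] : exists2 x, C x & ~ B x.
    apply: contrapT => nox; case: pP => _ + _; apply.
    have eCB : C = B.
      apply/seteqP; split=> // x Cx; apply: contrapT => nBx.
      by apply: nox; exists x.
    apply: (idealM_cancel (nzideal_invertibleW nC) mP (Omodule_ringO K)).
    by rewrite idealMr1 // idealMC PC.
  exact: quo_index_gt1 Cx nBx.
have [iAP _] := invertibleM iA iP.
have [finA1 eA1] := quo_index_mul_prime iA pP nP.
have [finA2 eA2] := IHk _ _ ltC iAP nC.
have [finO2 eO2] := IHk _ _ ltC iP nC.
rewrite -idealMA PC in finA2 eA2; rewrite PC in finO2 eO2.
have mAP := Omodule_idealM P mA; have mAB := Omodule_idealM B mA.
have [||_ ->] := quo_index_tower sO sP sB _ _ finP finO2 => //.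
  by case: nP => -[].
have sAP := Omodule_subgroup mAP; have sAB := Omodule_subgroup mAB.
rewrite eO2 -eA1 -eA2; apply: quo_index_tower => //.
  by apply: idealMS.
by rewrite idealMC; apply: idealM_subl => //; case: nP.
Qed.

Lemma norm_gt0 A : nzideal A -> (0 < N A)%N.
Proof.
move=> nA; apply: quo_index_gt0; last exact: nzideal_finite_index.
  exact/Omodule_subgroup/Omodule_ringO.
exact/Omodule_subgroup/Omodule_ideal/nA.1.
Qed.

Lemma normM A B : nzideal A -> nzideal B -> N (idealM A B) = (N A * N B)%N.
Proof.
move=> nA nB; have iA := nzideal_invertibleW nA.
have [finAB <-] := quo_index_mul iA nB.
have [mA _] := iA.
apply: (quo_index_tower _ _ _ _ _ (nzideal_finite_index finO nA) finAB).2.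
- exact/Omodule_subgroup/Omodule_ringO.
- exact/Omodule_subgroup.
- exact/Omodule_subgroup/Omodule_idealM.
- by rewrite idealMC; apply: idealM_subl => //; case: nB.
- by case: nA => -[].
Qed.

(** With J = B C ^ -1 and D = B C, which lies in both O and J, the index of
    D in O is N B * N C and its index in J = D C ^ -2 is N C ^ 2. *)
Lemma ideal_norm_frac B C : nzideal B -> nzideal C ->
  ideal_norm (idealM B (idealV C)) = (N B)%:R / (N C)%:R.
Proof.
move=> nB nC; set J := idealM B (idealV C).
have iB := nzideal_invertibleW nB; have iC := nzideal_invertibleW nC.
have [mB _] := iB; have [mC CV] := iC; have mV := Omodule_idealV C.
have [iJ _] := invertibleM iB (invertibleV iC).
have nCC := nzidealM nC nC; have nD := nzidealM nB nC.
pose D := idealM B C; have mD : Omodule D := Omodule_idealM C mB.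
have eD : idealM J (idealM C C) = D.
  by rewrite /J -idealMA (idealMA (idealV C)) (idealMC (idealV C)) CV idealM1.
have CO : C `<=` O by case: nC => -[].
have OV : O `<=` idealV C by move=> x Ox y /CO; apply: ringOM.
have DJ : D `<=` J by apply: idealMS => //; apply: subset_trans OV.
have DO : D `<=` O by case: nD => -[].
have mJ : Omodule J by case: iJ.
have mI : Omodule (O `&` J).
  have mO := Omodule_ringO K; case: mO (mJ) => O0 OD OM [J0 JD JM].
  split=> // [x y [? ?] [? ?]|a x Oa [? ?]]; split.
  - exact: OD.
  - exact: JD.
  - exact: OM.
  - exact: JM.
have [sO sJ sI sD] := And4 (Omodule_subgroup (Omodule_ringO K)) (Omodule_subgroup mJ)
  (Omodule_subgroup mI) (Omodule_subgroup mD).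
have finD : finite_index O D by apply: nzideal_finite_index.
have [finJ eJ] := quo_index_mul iJ nCC; rewrite eD in finJ eJ.
have DI : D `<=` O `&` J by move=> x Dx; split; [apply: DO | apply: DJ].
have finI : finite_index (O `&` J) D by apply: finite_indexS finD => // x [].
have finOI : finite_index O (O `&` J) by apply: finite_indexS finD.
have finJI : finite_index J (O `&` J) by apply: finite_indexS finJ.
have [||_ eO] := quo_index_tower sO sI sD _ _ finOI finI => //.
have [||_ eJ'] := quo_index_tower sJ sI sD _ _ finJI finI => //.
have I0 : (0 < quo_index (O `&` J) D)%N by apply: quo_index_gt0.
have J0 : (0 < quo_index J (O `&` J))%N by apply: quo_index_gt0.
have C0 := norm_gt0 nC.
rewrite [N D]normM // in eO; rewrite eJ normM // in eJ'.
rewrite /ideal_norm; apply/eqP; rewrite eqr_div ?pnatr_eq0 -?lt0n // -!natrM eqr_nat.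
by rewrite -(eqn_pmul2r I0) mulnAC -eO -!mulnA -eJ'.
Qed.

(** Fractional ideals enter as quotients of ideals of finite index. *)
Definition has_norm J (q : rat) :=
  exists B C, [/\ nzideal B, nzideal C, J = idealM B (idealV C) &
    q = (N B)%:R / (N C)%:R].

Lemma has_normE J q : has_norm J q -> ideal_norm J = q.
Proof. by move=> [B [C [nB nC -> ->]]]; apply: ideal_norm_frac. Qed.

Lemma has_normM I J q r :
  has_norm I q -> has_norm J r -> has_norm (idealM I J) (q * r).
Proof.
move=> [B [C [nB nC -> ->]]] [B' [C' [nB' nC' -> ->]]].
exists (idealM B B'), (idealM C C'); split; try exact: nzidealM.
  have [_ ->] := invertibleM (nzideal_invertibleW nC) (nzideal_invertibleW nC').
  exact: idealMACA.
by rewrite !normM // !natrM mulf_div.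
Qed.

Lemma normO : N O = 1%N.
Proof. exact: (quo_index_id (Omodule_subgroup (Omodule_ringO K))).2. Qed.

Lemma idealVO : idealV O = O.
Proof. by rewrite -(idealV_unique (A := O) (B := O)) ?idealM1 //; apply: Omodule_ringO. Qed.

Lemma has_norm_ideal I : nzideal I -> has_norm I (N I)%:R.
Proof.
move=> nI; exists I, O; split=> //; first exact: nzideal_ringO.
  by rewrite idealVO idealMr1 //; apply/Omodule_ideal/nI.1.
by rewrite normO divr1.
Qed.

Lemma has_norm1 : has_norm O 1.
Proof. by have := has_norm_ideal nzideal_ringO; rewrite normO. Qed.

Lemma has_normV I : nzideal I -> has_norm (idealV I) (N I)%:R^-1.
Proof.
move=> nI; exists O, I; split=> //; first exact: nzideal_ringO.
  by rewrite idealM1 //; apply: Omodule_idealV.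
by rewrite normO mul1r.
Qed.

Lemma has_norm_idealX I z : nzideal I -> has_norm (idealX I z) ((N I)%:R ^ z).
Proof.
move=> nI; case: z => k.
  elim: k => [|k IHk] /=; first exact: has_norm1.
  rewrite -exprnP exprS.
  by apply: has_normM => //; apply: has_norm_ideal.
have -> : (N I)%:R ^ Negz k = (N I)%:R^-1 ^+ k.+1 :> rat by rewrite NegzE -exprnN -exprVn.
rewrite [idealX _ _]/=; elim: k => [|k IHk].
  have /= := has_normM (has_normV nI) has_norm1.
  by rewrite mulr1 expr1.
by rewrite exprS; apply: has_normM => //; apply: has_normV.
Qed.

Lemma has_norm_big (T : eqType) (s : seq T) (F : T -> set K) (q : T -> rat) :
  (forall t, t \in s -> has_norm (F t) (q t)) ->
  has_norm (\big[@idealM K / O]_(t <- s) F t) (\prod_(t <- s) q t).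
Proof.
elim: s => [|t s IHs] Fq.
  by rewrite !big_nil; apply: has_norm1.
rewrite !big_cons; apply: has_normM; first by apply: Fq; rewrite mem_head.
by apply: IHs => u us; apply: Fq; rewrite inE us orbT.
Qed.

End Norm.

(** * Primes over p and their residual degrees *)
Section IdealCongruence.
Variable K : fieldExtType rat.
Implicit Types (x y : K) (I P : set K).
Notation O := (ringO K).

Lemma ideal_prod_congr I (T : Type) (s : seq T) (R : pred T) (F G : T -> K) :
    is_ideal I -> (forall t, R t -> [/\ O (F t), O (G t) & I (F t - G t)]) ->
  I (\prod_(t <- s | R t) F t - \prod_(t <- s | R t) G t).
Proof.
move=> iI FG.
suff [] : [/\ O (\prod_(t <- s | R t) F t), O (\prod_(t <- s | R t) G t) &
  I (\prod_(t <- s | R t) F t - \prod_(t <- s | R t) G t)] by [].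
apply: (big_ind2 (fun x y => [/\ O x, O y & I (x - y)])) => //.
  by split; rewrite ?subrr; try exact: ringO1; case: iI.
move=> x x' y y' [Ox Ox' Ixx'] [Oy Oy' Iyy']; split; try exact: ringOM.
rewrite (_ : _ - _ = y * (x - x') + x' * (y - y')); last by ring.
by have [_ _ ID IM] := iI; apply: ID; apply: IM.
Qed.

Lemma ideal_expr_congr I x y k : is_ideal I -> O x -> O y -> I (x - y) ->
  I (x ^+ k - y ^+ k).
Proof.
move=> iI Ox Oy Ixy; rewrite -(card_ord k) -!prodr_const.
exact: ideal_prod_congr.
Qed.

(** A polynomial over O that vanishes at a modulo P is a multiple of X - a
    modulo P, as in Lagrange's theorem over the domain O / P. *)
Lemma max_roots_mod_prime P (h : {poly K}) (s : seq K) :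
    prime_ideal P -> (forall k, O h`_k) -> ~ P (lead_coef h) ->
    {in s, forall x, O x /\ P h.[x]} ->
    pairwise (fun x y => ~~ `[< P (x - y) >]) s ->
  (size s < size h)%N.
Proof.
move=> pP; have [iP _ pP2] := pP; have mP := Omodule_ideal iP.
elim: s h => [|a s IHs] h Oh nPh rh.
  rewrite size_poly_gt0 => _; apply/eqP => h0; apply: nPh.
  by rewrite h0 lead_coef0; case: mP.
rewrite pairwise_cons => /andP[/allP as_ ps].
have [Oa Pha] := rh a (mem_head a s).
have [g Og eg] : exists2 g : {poly K}, forall k, O g`_k & h = g * ('X - a%:P) + h.[a]%:P.
  move: Oh; clear -Oa; elim/poly_ind: h => [|h c IHh] Oh.
    exists 0 => [k|]; first by rewrite coef0; apply: ringO0.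
    by rewrite horner0 mul0r add0r.
  have [k|g Og eg] := IHh.
    by have := Oh k.+1; rewrite coefD coefMX coefC /= addr0.
  have Oha : O h.[a].
    rewrite horner_coef; apply: ringO_sum => k _; apply: ringOM; last exact: ringOX.
    by have := Oh k.+1; rewrite coefD coefMX coefC /= addr0.
  exists (g * 'X + h.[a]%:P) => [k|].
    rewrite coefD coefMX coefC; case: k => [|k] /=; first by rewrite add0r.
    by rewrite addr0.
  by rewrite {1}eg hornerMXaddC polyCD polyCM; ring.
have g0 : g != 0.
  by apply/eqP => g0; apply: nPh; rewrite eg g0 mul0r add0r lead_coefC.
have size_low : (size (h.[a]%:P) < size (g * ('X - a%:P))%R)%N.
  rewrite size_Mmonic ?monicXsubC // size_XsubC addn2 /= ltnS.
  by rewrite (leq_trans (size_polyC_leq1 _)) // size_poly_gt0.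
have size_h : size h = (size g).+1.
  by rewrite eg size_polyDl // size_Mmonic ?monicXsubC // size_XsubC addn2.
have lead_h : lead_coef h = lead_coef g.
  by rewrite {1}eg lead_coefDl // lead_coef_Mmonic ?monicXsubC.
rewrite size_h ltnS; apply: IHs => // [|x xs]; first by rewrite -lead_h.
have [Ox Phx] : O x /\ P h.[x] by apply: rh; rewrite inE xs orbT.
split=> //; have nPax : ~ P (a - x) by apply/asboolPn; apply: as_.
have := OmoduleB mP Phx Pha; rewrite [h in h.[x]]eg !hornerE addrK.
have Ogx : O g.[x].
  by rewrite horner_coef; apply: ringO_sum => k _; apply: ringOM => //; apply: ringOX.
move=> /(pP2 _ _ Ogx (ringOB Ox Oa))[]// /(OmoduleN mP); by rewrite opprB.
Qed.

End IdealCongruence.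

Section FiniteField.
Variable K : fieldExtType rat.
Implicit Types (x y : K) (I P : set K).
Notation O := (ringO K).
Notation N := (quo_index O).
Hypothesis finO : forall m : nat, (0 < m)%N -> finite_index O (@multiples K m).

(** Fermat's little theorem in O / P: multiplication by x permutes the nonzero
    classes, so their product a satisfies x ^ (N P - 1) a = a modulo P. *)
Lemma fermat_mod_prime P x : prime_ideal P -> nzideal P -> O x -> P (x ^+ N P - x).
Proof.
move=> pP nP Ox; have [iP _ pP2] := pP; have mP := Omodule_ideal iP.
have [PO P0 PD PM] := iP; have sP := Omodule_subgroup mP.
have finP := nzideal_finite_index finO nP.
have N0 : (0 < N P)%N.
  by apply: quo_index_gt0 => //; apply/Omodule_subgroup/Omodule_ringO.
have [Px|nPx] := pselect (P x).
  apply: OmoduleB => //; rewrite -(prednK N0) exprSr; apply: PM => //.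
  exact: ringOX.
have [r rP] := finite_index_quo sP finP.
have Or t : O (r t) := rP.1 t.
have /choice[f fP] t : exists s, P (x * r t - r s).
  by have [s [Ps _]] := rP.2 _ (ringOM Ox (Or t)); exists s.
have [t0 [Pt0 t0P]] := rP.2 0 (ringO0 K); rewrite sub0r in Pt0.
have {}Pt0 : P (r t0) by rewrite -[r t0]opprK; apply: OmoduleN.
have nPr t : t != t0 -> ~ P (r t).
  move=> /eqP nt Pt; apply: nt; apply/esym/t0P.
  by rewrite sub0r; apply: OmoduleN.
have f_inj : injective f.
  move=> s t fst; apply: (transversal_inj rP (Or s)); first by rewrite subrr.
  have : P (x * (r s - r t)).
    rewrite mulrBr; apply: subgroup_trans (fP s) _ => //.
    by rewrite fst; apply: (subgroup_sym sP (fP t)).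
  by move=> /(pP2 _ _ Ox (ringOB (Or s) (Or t)))[].
have ft0 : f t0 = t0.
  apply/esym/t0P; rewrite sub0r; apply: OmoduleN => //.
  by rewrite -(subKr (x * r t0) (r (f t0))); apply: OmoduleB (PM _ _ Ox Pt0) (fP t0).
pose a := \prod_(t | t != t0) r t.
have Oa : O a by apply: ringO_prod.
have nPa : ~ P a.
  suff [] : O a /\ ~ P a by [].
  rewrite /a; apply: (big_ind (fun z => O z /\ ~ P z)) => [|y z [Oy nPy] [Oz nPz]|t /nPr //].
  - by split; [exact: ringO1 | exact: prime_ideal1].
  - by split; [exact: ringOM | case/pP2].
have : P (\prod_(t | t != t0) (x * r t) - a).
  have -> : a = \prod_(t | t != t0) r (f t).
    rewrite /a (reindex_inj f_inj) /=; apply: eq_bigl => t.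
    by rewrite -{1}ft0 (inj_eq f_inj).
  by apply: ideal_prod_congr => // t _; split; [exact: ringOM | exact: Or | exact: fP].
rewrite big_split /= prodr_const (cardC1 t0) card_ord -/a.
rewrite -{2}[a]mul1r -mulrBl => /pP2[]//.
  by apply: ringOB; [exact: ringOX | exact: ringO1].
move=> Px1; rewrite -(prednK N0) exprSr -{3}[x]mul1r -mulrBl mulrC.
exact: PM.
Qed.

End FiniteField.

Section PrimesOverP.
Variable K : fieldExtType rat.
Implicit Types (x y : K) (I P : set K).
Notation O := (ringO K).
Notation N := (quo_index O).
Variables (n : nat) (b : 'I_n -> K) (p : nat).
Hypotheses (hb : integral_basis b) (hp : prime p).
Let finO := finite_index_multiples hb.

Lemma nzideal_over P : is_ideal P -> P p%:R -> nzideal P.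
Proof. by move=> iP Pp; split=> //; exists p; rewrite ?prime_gt0. Qed.

Lemma ideal_natrM I (k l : nat) : is_ideal I -> I l%:R -> I (k * l)%:R.
Proof. by case=> _ _ _ IM Il; rewrite natrM; apply: IM => //; apply: ringO_nat. Qed.

Lemma natr_Fp_congr P k : is_ideal P -> P p%:R ->
  P (((k%:R : 'F_p) : nat)%:R - k%:R).
Proof.
move=> iP Pp; rewrite val_Fp_nat // {2}(divn_eq k p) natrD opprD addrCA subrr addr0.
by apply: OmoduleN; [exact: Omodule_ideal | exact: ideal_natrM].
Qed.

(** The representatives in nat of elements of 'F_p are compatible with linear
    combinations modulo P. *)
Lemma natr_Fp_sum_congr P (T : finType) (c d : T -> 'F_p) : is_ideal P -> P p%:R ->
  P (((\sum_t c t * d t : 'F_p)%R : nat)%:R - \sum_t (c t : nat)%:R * (d t : nat)%:R).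
Proof.
move=> iP Pp; have sP := Omodule_subgroup (Omodule_ideal iP).
have -> : \sum_t c t * d t = (\sum_t (c t * d t)%N)%:R :> 'F_p.
  by rewrite natr_sum; apply: eq_bigr => t _; rewrite natrM !natr_Zp.
apply: subgroup_trans (natr_Fp_congr _ iP Pp) _ => //.
rewrite natr_sum (eq_bigr (fun t => (c t : nat)%:R * (d t : nat)%:R)) ?subrr.
  by case: sP.
by move=> t _; rewrite natrM.
Qed.

Definition lift_Fp (v : 'rV['F_p]_n) : K := \sum_(j < n) (v 0 j : nat)%:R * b j.

Lemma lift_Fp_congr P (T : finType) (c : T -> 'F_p) (v : T -> 'rV['F_p]_n) :
    is_ideal P -> P p%:R ->
  P (lift_Fp (\sum_t c t *: v t) - \sum_t (c t : nat)%:R * lift_Fp (v t)).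
Proof.
move=> iP Pp; have mP := Omodule_ideal iP.
under [X in _ - X]eq_bigr do rewrite mulr_sumr.
rewrite exchange_big -sumrB; apply: Omodule_sum => // j _ /=.
under [X in _ - X]eq_bigr do rewrite mulrA.
rewrite -mulr_suml -mulrBl; apply: OmoduleMr => //; first exact: hb.1.
rewrite (_ : (\sum_t c t *: v t) 0 j = \sum_t c t * v t 0 j).
  exact: natr_Fp_sum_congr.
by rewrite summxE; apply: eq_bigr => t _; rewrite mxE.
Qed.

Lemma lift_FpD_congr P (u v : 'rV['F_p]_n) : is_ideal P -> P p%:R ->
  P (lift_Fp (u + v) - (lift_Fp u + lift_Fp v)).
Proof.
move=> iP Pp.
have := @lift_Fp_congr P bool (fun=> 1) (fun i => if i then u else v) iP Pp.
have e1 : nat_of_ord (1 : 'F_p) = 1%N.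
  by rewrite -[1]/(1%:R) val_Fp_nat // modn_small // prime_gt1.
by rewrite !big_bool !scale1r e1 !mul1r.
Qed.

Lemma lift_Fp_surj P x : is_ideal P -> P p%:R -> O x -> exists v, P (x - lift_Fp v).
Proof.
move=> iP Pp Ox; have [_ rP] := transversal_multiples hb (prime_gt0 hp).
have [c [Mc _]] := rP x Ox; exists (\row_j (c j)%:R).
apply: (multiples_sub iP Pp); rewrite (_ : lift_Fp _ = \sum_(i < n) (c i)%:R * b i) //.
by apply: eq_bigr => j _; rewrite mxE val_Fp_nat // modn_small.
Qed.

(** The elements of P form a subspace of O / p O = 'F_p ^ n; a basis of a
    complement of it lifts to a basis of O / P. *)
Lemma residual_degree_exists P : is_ideal P -> P p%:R -> exists k, residual_degree p P k.
Proof.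
move=> iP Pp; have mP := Omodule_ideal iP; have sP := Omodule_subgroup mP.
pose s := [seq v <- enum {: 'rV['F_p]_n} | `[< P (lift_Fp v) >]].
pose U := <<s>>%VS.
have memU (v : 'rV['F_p]_n) : v \in U <-> P (lift_Fp v).
  split=> [|Pv]; last first.
    by apply: memv_span; rewrite mem_filter mem_enum andbT; apply/asboolP.
  pose c i := coord (in_tuple s) i v.
  move=> Uv; rewrite (coord_span (X := in_tuple s) Uv).
  have Pc := lift_Fp_congr c (fun i => (in_tuple s)`_i) iP Pp.
  rewrite -(subrK (\sum_i (c i : nat)%:R * lift_Fp (in_tuple s)`_i) (lift_Fp _)).
  apply: subgroupD => //; apply: Omodule_sum => // i _.
  have [_ _ _ PM] := iP; apply: PM; first exact: ringO_nat.
  by have := mem_nth 0 (ltn_ord i); rewrite mem_filter => /andP[/asboolP].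
pose X := vbasis (U^C)%VS; exists (\dim (U^C)%VS), (fun i => lift_Fp X`_i); split=> [i|x Ox].
  by apply: ringO_sum => j _; apply: ringOM; [exact: ringO_nat | exact: hb.1].
have congrX (c : 'I_(\dim U^C%VS) -> 'F_p) :
    P (x - \sum_i (c i : nat)%:R * lift_Fp X`_i) <-> P (x - lift_Fp (\sum_i c i *: X`_i)).
  have Pc := lift_Fp_congr c (fun i => X`_i) iP Pp.
  split=> Px; apply: subgroup_trans Px _ => //; exact: subgroup_sym.
have [v Pv] := lift_Fp_surj iP Pp Ox.
have /memv_addP[u Uu [w Ww ev]] : v \in (U + U^C)%VS by rewrite addv_complf memvf.
have Pw : P (x - lift_Fp w).
  apply: subgroup_trans Pv _ => //; rewrite ev.
  have /(subgroupD sP)/(_ ((memU u).1 Uu)) := lift_FpD_congr u w iP Pp.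
  by rewrite opprD addrA addrAC subrK.
exists [ffun i => coord X i w]; split=> [|c /congrX Pc].
  apply/congrX; rewrite (eq_bigr (fun i => coord X i w *: X`_i)).
    by rewrite -coord_vbasis.
  by move=> i _; rewrite ffunE.
set z := \sum_i _ in Pc.
have Wz : z \in (U^C)%VS.
  apply: memv_suml => i _; apply: memvZ; apply: vbasis_mem; apply: mem_nth.
  by rewrite size_tuple.
suff ewz : w = z.
  apply/ffunP => i; rewrite ffunE ewz /z.
  by rewrite coord_sum_free //; apply: (basis_free (vbasisP _)).
apply/eqP; rewrite -subr_eq0 -memv0 -(capv_compl U) memv_cap.
apply/andP; split; last exact: memvB.
apply/memU.
have Pwz := subgroup_trans sP (subgroup_sym sP Pw) Pc.
have := lift_FpD_congr (w - z) z iP Pp; rewrite subrK => Pwz'.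
have := OmoduleB mP Pwz Pwz'; rewrite (_ : _ - _ - _ = lift_Fp (w - z)) //.
by ring.
Qed.

Lemma residual_degree_norm P k : is_ideal P -> residual_degree p P k -> N P = (p ^ k)%N.
Proof.
move=> iP [e [Oe eP]].
have rP : transversal O P
    (fun c : {ffun 'I_k -> 'F_p} => \sum_(i < k) (nat_of_ord (c i))%:R * e i).
  split=> // c; apply: ringO_sum => i _; apply: ringOM => //; exact: ringO_nat.
rewrite (quo_index_transversal _ rP); last exact/Omodule_subgroup/Omodule_ideal.
by rewrite card_ffun card_Fp // card_ord.
Qed.

Lemma residual_degreeP P k : is_ideal P -> P p%:R ->
  residual_degree p P k <-> N P = (p ^ k)%N.
Proof.
move=> iP Pp; split; first exact: residual_degree_norm.
have [l degl] := residual_degree_exists iP Pp.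
by rewrite (residual_degree_norm iP degl) => /(expnI (prime_gt1 hp)) <-.
Qed.

Lemma prime_factorP P : prime_factor p P <-> prime_ideal P /\ P p%:R.
Proof.
have genE : idealgen [set p%:R : K] = multiples p.
  apply/seteqP; split=> [|_ [y Oy <-]]; last by rewrite mulrC; apply: mem_idealM.
  have [_ M0 MD _] := ideal_multiples K p.
  by apply: idealM_sub => // a _ Oa ->; exists a => //; rewrite mulrC.
split=> -[pP].
  move=> [Q iQ eQ]; split=> //; have [iP _ _] := pP.
  apply: (idealM_subl iQ (Omodule_ideal iP)); rewrite idealMC eQ genE.
  exact: multiples_self.
move=> Pp; split=> //; have [iP _ _] := pP; have nP := nzideal_over iP Pp.
have mM := Omodule_ideal (ideal_multiples K p).
have PV := nzideal_invertible finO nP.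
exists (idealM (idealV P) (multiples p)); last by rewrite idealMA PV idealM1 // genE.
have [M0 MD MM] := Omodule_idealM (multiples p) (Omodule_idealV P).
split=> //; rewrite -PV (idealMC P); apply: idealMS => //.
exact: multiples_sub.
Qed.

(** In the field O / P with p ^ f elements, x ^ (p ^ d) = x for all x if and
    only if f divides d: for r = d mod f the polynomial X ^ (p ^ r) - X
    would otherwise have too many roots. *)
Lemma frobenius_fixes_mod_prime P d f : prime_ideal P -> P p%:R -> N P = (p ^ f)%N ->
  (forall x, O x -> P (x ^+ (p ^ d) - x)) <-> (f %| d)%N.
Proof.
move=> pP Pp NP; have [iP _ _] := pP; have nP := nzideal_over iP Pp.
have sP := Omodule_subgroup (Omodule_ideal iP).
have frobM a x : O x -> P (x ^+ (p ^ (a * f)) - x).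
  move=> Ox; elim: a => [|a IHa]; first by rewrite mul0n expn0 expr1 subrr; case: iP.
  rewrite mulSn addnC expnD exprM; apply: subgroup_trans IHa => //.
  rewrite -NP; apply: fermat_mod_prime => //; exact: ringOX.
split=> [frob|/dvdnP[a ->]]; last exact: frobM.
have f0 : (0 < f)%N.
  rewrite lt0n; apply/eqP => f0; have := quo_index_gt1 _ sP _ (ringO1 K) (prime_ideal1 pP).
  rewrite NP f0 expn0 ltnn => H; suff : false by []; apply: H.
    exact/Omodule_subgroup/Omodule_ringO.
  exact: nzideal_finite_index.
rewrite /dvdn; apply: contraT; rewrite -lt0n => r0; set r := (d %% f)%N in r0.
have frobr x : O x -> P (x ^+ (p ^ r) - x).
  move=> Ox; apply: subgroup_trans (frob x Ox) => //; apply: subgroup_sym => //.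
  rewrite {1}(divn_eq d f) expnD exprM; apply: ideal_expr_congr => //.
    exact: ringOX.
  exact: frobM.
have pr1 : (1 < p ^ r)%N by rewrite -(expn0 p) ltn_exp2l ?prime_gt1.
pose h : {poly K} := 'X^(p ^ r) - 'X.
have size_low : (size (- 'X : {poly K}) < size ('X^(p ^ r) : {poly K})%R)%N.
  by rewrite size_polyN size_polyX size_polyXn ltnS.
have size_h : size h = (p ^ r).+1 by rewrite size_polyDl // size_polyXn.
have [e eP] := finite_index_quo sP (nzideal_finite_index finO nP).
suff : (N P < (p ^ r).+1)%N.
  by rewrite NP ltnS leq_exp2l ?prime_gt1 // leqNgt ltn_mod f0.
have := @max_roots_mod_prime _ P h [seq e t | t <- enum 'I_(N P)] pP.
rewrite size_h size_map -cardE card_ord; apply=> [k||_ /mapP[t _ ->]|].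
- rewrite !coefE; apply: ringOB; exact: ringO_nat.
- by rewrite lead_coefDl // lead_coefXn; apply: prime_ideal1.
- have Oe := eP.1 t; split=> //; rewrite !hornerE; exact: frobr.
rewrite pairwise_map; have := enum_uniq 'I_(N P); rewrite uniq_pairwise.
apply: sub_pairwise => s t /= nst; apply/asboolPn => Pst; case/eqP: nst.
apply: (transversal_inj eP (eP.1 s)) => //; by rewrite subrr; case: iP.
Qed.

Lemma prime_ideal_incl P Q : prime_ideal P -> prime_ideal Q -> nzideal Q ->
  Q `<=` P -> Q = P.
Proof.
move=> pP pQ nQ QP; apply/seteqP; split=> // x Px.
have [[PO _ _ _] _ _] := pP; have mP := Omodule_ideal (let: And3 iP _ _ := pP in iP).
apply: contrapT => nQx; have [y Oy /QP P1] := prime_ideal_inverse finO pQ nQ (PO _ Px) nQx.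
apply: (prime_ideal1 pP); rewrite -(subrK (x * y) 1).
by case: (mP) => _ PD _; apply: PD => //; apply: OmoduleMr.
Qed.

Lemma bigI_mem (s : seq (set K)) x :
  (\big[setI/O]_(Q <- s) Q) x <-> O x /\ (forall Q, Q \in s -> Q x).
Proof.
elim: s => [|P s IHs]; first by rewrite big_nil; split=> [|[]].
rewrite big_cons; split=> [[Px /IHs[Ox sx]]|[Ox Psx]].
  by split=> // Q; rewrite inE => /predU1P[->|/sx].
split; first by apply: Psx; rewrite mem_head.
by apply/IHs; split=> // Q Qs; apply: Psx; rewrite inE Qs orbT.
Qed.

Lemma ideal_setI (A B : set K) : is_ideal A -> is_ideal B -> is_ideal (A `&` B).
Proof.
move=> [AO A0 AD AM] [BO B0 BD BM]; split=> [x [/AO]//||x y [Ax Bx] [Ay By]|a x Oa [Ax Bx]].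
- by split.
- by split; [exact: AD | exact: BD].
- by split; [exact: AM | exact: BM].
Qed.

Lemma ideal_bigI (s : seq (set K)) :
  {in s, forall Q, prime_ideal Q /\ nzideal Q} -> is_ideal (\big[setI/O]_(Q <- s) Q).
Proof.
move=> hs; rewrite big_seq; elim/big_ind: _ => [|A B|Q /hs[[]//]].
  exact: ideal_ringO.
exact: ideal_setI.
Qed.

Lemma prime_avoidance P (s : seq (set K)) : prime_ideal P -> P \notin s ->
    {in s, forall Q, prime_ideal Q /\ nzideal Q} ->
  exists2 a, (\big[setI/O]_(Q <- s) Q) a & ~ P a.
Proof.
move=> pP; elim: s => [|Q s IHs].
  by rewrite big_nil; exists 1; [exact: ringO1 | exact: prime_ideal1].
rewrite inE negb_or => /andP[/eqP nPQ /IHs{}IHs] hQs.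
have hs : {in s, forall R, prime_ideal R /\ nzideal R}.
  by move=> R Rs; apply: hQs; rewrite inE Rs orbT.
have [a sa nPa] := IHs hs; have [pQ nQ] := hQs Q (mem_head Q s).
have [c Qc nPc] : exists2 c, Q c & ~ P c.
  apply: contrapT => noc; apply: nPQ; apply/esym/prime_ideal_incl => // c Qc.
  by apply: contrapT => nPc; apply: noc; exists c.
have [sO _ _ sM] := ideal_bigI hs; have [[QO _ _ QM] _ _] := pQ.
have Oa := sO _ sa; have Oc := QO _ Qc.
exists (a * c); last by case: pP => _ _ pP2 /pP2[].
by rewrite big_cons; split; [exact: QM | rewrite mulrC; exact: sM].
Qed.

(** The Chinese remainder theorem, at the level of cardinals: for a in the
    intersection M of the other primes and not in P, multiplication by a
    induces an isomorphism from O / P onto M / (P :&: M). *)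
Lemma norm_bigI_primes (s : seq (set K)) : uniq s ->
    {in s, forall Q, prime_ideal Q /\ nzideal Q} ->
  let M := \big[setI/O]_(Q <- s) Q in
  finite_index O M /\ N M = (\prod_(Q <- s) N Q)%N.
Proof.
move=> + + /=; elim: s => [_ _|P s IHs].
  by rewrite !big_nil; apply/quo_index_id/Omodule_subgroup/Omodule_ringO.
rewrite cons_uniq => /andP[nPs us] hPs.
have hs : {in s, forall R, prime_ideal R /\ nzideal R}.
  by move=> R Rs; apply: hPs; rewrite inE Rs orbT.
have [pP nP] := hPs P (mem_head P s).
have [a Ma nPa] := prime_avoidance pP nPs hs.
have [] := IHs us hs; rewrite !big_cons; set M := \big[setI/O]_(Q <- s) Q.
move=> finM eM; have iM : is_ideal M := ideal_bigI hs; have [MO _ _ MM] := iM.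
have iP := nP.1; have [PO _ _ PM] := iP; have Oa : O a := MO _ Ma.
have [sO sP sM sPM] := And4 (Omodule_subgroup (Omodule_ringO K))
  (Omodule_subgroup (Omodule_ideal iP)) (Omodule_subgroup (Omodule_ideal iM))
  (Omodule_subgroup (Omodule_ideal (ideal_setI iP iM))).
have [finPM ePM] : finite_index M (P `&` M) /\ quo_index M (P `&` M) = N P.
  apply: (quo_index_iso (f := fun x => a * x)) => // [x Ox|x y Ox Oy|y My|].
  - by rewrite mulrC; apply: MM.
  - rewrite -mulrBr; split=> [[Paxy _]|Pxy].
      by have [_ _ pP2] := pP; case/pP2: Paxy => //; apply: ringOB.
    by split; [exact: PM | rewrite mulrC; apply: MM => //; apply: ringOB].
  - have [w Ow Pw] := prime_ideal_inverse finO pP nP Oa nPa; have Oy := MO _ My.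
    exists (w * y); first exact: ringOM.
    rewrite mulrA (_ : _ - _ = y * (1 - a * w)); last by ring.
    split; first exact: PM.
    rewrite mulrC; apply: MM => //; apply: ringOB; first exact: ringO1.
    exact: ringOM.
  - exact: nzideal_finite_index.
have [||finO' ->] := quo_index_tower sO sM sPM _ _ finM finPM => //.
by split=> //; rewrite ePM eM mulnC.
Qed.

(** If x ^ q = x in O / L with q > 1, then e = x ^ (q - 1) is idempotent modulo
    L; were it nonzero, a prime containing its annihilator, hence 1 - e, could
    not contain x. *)
Lemma radical_mem L q x : nzideal L -> (1 < q)%N -> L (x ^+ q - x) -> O x ->
  (forall P, prime_ideal P -> L `<=` P -> P x) -> L x.
Proof.
move=> nL q1 Lq Ox Px; have [iL [m m0 Lm]] := nL; have [LO L0 LD LM] := iL.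
have mL := Omodule_ideal iL.
pose e := x ^+ q.-1; have ex : e * x = x ^+ q by rewrite -exprSr prednK // ltnW.
have Oe : O e by apply: ringOX.
pose A := [set y | O y /\ L (e * y)].
have iA : is_ideal A.
  split=> [y []//||y z [Oy Ly] [Oz Lz]|a y Oa [Oy Ly]]; split.
  - exact: ringO0.
  - by rewrite mulr0.
  - exact: ringOD.
  - by rewrite mulrDr; apply: LD.
  - exact: ringOM.
  - by rewrite mulrCA; apply: LM.
have LA : L `<=` A by move=> y Ly; split; [exact: LO | exact: LM].
have nA : nzideal A by split=> //; exists m => //; apply: LA.
have [[_ Le]|nA1] := pselect (A 1).
  rewrite mulr1 in Le; rewrite -(subKr (x ^+ q) x); apply: OmoduleB => //.
  by rewrite -ex; apply: OmoduleMr.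
have [P pP AP] := exists_prime finO nA nA1; have [iP _ _] := pP; have [_ _ PD PM] := iP.
have {}Px : P x by apply: Px => //; apply: subset_trans AP.
have [] := prime_ideal1 pP; rewrite -(subrK e 1); apply: PD.
  apply: AP; split; first by apply: ringOB => //; apply: ringO1.
  rewrite mulrBr mulr1 (_ : e - e * e = - (x ^+ q.-2 * (x ^+ q - x))).
    by apply: OmoduleN => //; apply: LM => //; apply: ringOX.
  have -> : e = x ^+ q.-2 * x by rewrite -exprSr /e; case: (q) q1 => [|[|]].
  have -> : x ^+ q = x ^+ q.-2 * x * x by rewrite -!exprSr; case: (q) q1 => [|[|]].
  by ring.
rewrite /e -(prednK (_ : 0 < q.-1)%N); last by case: (q) q1 => [|[|]].
by rewrite exprSr; apply: PM => //; apply: ringOX.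
Qed.

Definition primes_over : set (set K) := [set P | prime_ideal P /\ P p%:R].

Lemma finite_primes_over : finite_set primes_over.
Proof.
have [k [r rP]] := finO (prime_gt0 hp).
pose decode (E : {set 'I_k}) : set K :=
  [set x | O x /\ exists2 t, t \in E & multiples p (x - r t)].
apply: (@sub_finite_set _ _ (decode @` setT)); last exact/finite_image/finite_finset.
move=> P [[iP _ _] Pp]; exists [set t | `[< P (r t) >]]%SET => //.
have [PO _ _ _] := iP; have MP := multiples_sub iP Pp.
have sP := Omodule_subgroup (Omodule_ideal iP).
apply/seteqP; split=> [x [Ox [t]]|x Px].
  by rewrite inE => /asboolP Pt /MP Pxt; rewrite -(subrK (r t) x); apply: subgroupD.
have Ox := PO _ Px; split=> //; have [t [Mt _]] := rP.2 x Ox.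
exists t => //; rewrite inE; apply/asboolP.
by rewrite -(subKr x (r t)); apply: sP.2 => //; apply: MP.
Qed.

Lemma norm_radical L q : is_ideal L -> L p%:R -> (1 < q)%N ->
    (forall x, O x -> L (x ^+ q - x)) ->
  N L = (\prod_(P <- fset_set primes_over | `[< L `<=` P >]) N P)%N.
Proof.
move=> iL Lp q1 Lq; have nL := nzideal_over iL Lp.
rewrite -big_filter; set s := filter _ _.
have memS P : P \in fset_set primes_over -> prime_ideal P /\ P p%:R.
  by rewrite in_fset_set ?inE //; apply: finite_primes_over.
have hs : {in s, forall Q, prime_ideal Q /\ nzideal Q}.
  move=> Q; rewrite mem_filter => /andP[_ /memS[pQ Qp]]; split=> //.
  by apply: nzideal_over => //; case: pQ.
have us : uniq s by apply: filter_uniq; apply: fset_uniq.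
have [_ <-] := norm_bigI_primes us hs.
congr (N _); apply/seteqP; split=> x.
  move=> Lx; apply/bigI_mem; split; first by case: iL => LO _ _ _; apply: LO.
  by move=> Q; rewrite mem_filter => /andP[/asboolP LQ _]; apply: LQ.
move=> /bigI_mem[Ox sx]; apply: (radical_mem nL q1 (Lq x Ox) Ox) => P pP LP.
apply: sx; rewrite mem_filter in_fset_set ?inE; last exact: finite_primes_over.
by apply/andP; split; [exact/asboolP | rewrite inE; split=> //; exact: LP].
Qed.

End PrimesOverP.

(** * The ideal generated by the differences xi_i ^ (p ^ d) - xi_i *)
Lemma expn_succ_mod (p q : nat) : exists c, (p.+1 ^ q = 1 + q * p + p ^ 2 * c)%N.
Proof.
elim: q => [|q [c IHq]]; first by exists 0%N; rewrite muln0.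
by exists (c + q + c * p)%N; rewrite expnS IHq; ring.
Qed.

(** The cofactor is m = p ^ d - 1 modulo p, hence prime to p as d > 0. *)
Lemma expn_succ_sub (p d : nat) : prime p -> (0 < d)%N ->
  exists2 m, coprime p m & (p.+1 ^ (p ^ d) = p.+1 + p * m)%N.
Proof.
move=> hp d0; have [c eq_c] := expn_succ_mod p (p ^ d).
have q0 : (0 < p ^ d)%N by rewrite expn_gt0 prime_gt0.
exists ((p ^ d).-1 + p * c)%N; last first.
  by rewrite eq_c -{1}(prednK q0); ring.
have : (p %| ((p ^ d).-1 + p * c).+1)%N.
  by rewrite -addSn prednK // dvdn_addr ?dvdn_mulr // dvdn_exp.
rewrite prime_coprime //; apply: contraL => pm; rewrite -addn1 dvdn_addr //.
by rewrite gtnNdvd // prime_gt1.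
Qed.

Section Frobenius.
Variables (K : fieldExtType rat) (p : nat) (L : set K).
Hypotheses (hp : prime p) (iL : is_ideal L) (Lp : L p%:R).
Implicit Types x y : K.
Notation O := (ringO K).

Let mL := Omodule_ideal iL.
Let sL := Omodule_subgroup mL.

Lemma frobeniusD1 x y : O x -> O y -> L ((x + y) ^+ p - (x ^+ p + y ^+ p)).
Proof.
move=> Ox Oy; have [q ep] : exists q, p = q.+1 by exists p.-1; rewrite prednK ?prime_gt0.
rewrite exprDn ep big_ord_recl big_ord_recr /= -ep bin0 subn0 expr0 mulr1 mulr1n.
rewrite /bump /= add1n -ep subnn expr0 mul1r binn mulr1n.
have cancel a s c : a + (s + c) - (a + c) = s :> K by ring.
rewrite cancel.
apply: Omodule_sum => // i _; rewrite add1n.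
have /dvdnP[k ->] : (p %| 'C(p, i.+1))%N.
  by apply: prime_dvd_bin => //=; rewrite [X in (_ < X)%N]ep ltnS ltn_ord.
rewrite -mulr_natr; have [_ _ _ LM] := iL; apply: LM; last exact: ideal_natrM.
by apply: ringOM; apply: ringOX.
Qed.

Lemma frobeniusD d x y : O x -> O y ->
  L ((x + y) ^+ (p ^ d) - (x ^+ (p ^ d) + y ^+ (p ^ d))).
Proof.
move=> Ox Oy; elim: d => [|d IHd]; first by rewrite !expr1 subrr; case: iL.
rewrite expnSr !exprM; set u := x ^+ _ in IHd *; set v := y ^+ _ in IHd *.
have [Ou Ov] : O u /\ O v by split; apply: ringOX.
apply: subgroup_trans (frobeniusD1 Ou Ov) => //; apply: ideal_expr_congr => //.
  by apply: ringOX; apply: ringOD.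
exact: ringOD.
Qed.

(** Modulo L the map x |-> x ^ (p ^ d) is additive, so the elements that it
    fixes form a group. *)
Lemma frobenius_fixes n (b : 'I_n -> K) d : integral_basis b ->
    (forall i, L (b i ^+ (p ^ d) - b i)) ->
  forall x, O x -> L (x ^+ (p ^ d) - x).
Proof.
move=> [Ob bP] Lb; pose D x := O x /\ L (x ^+ (p ^ d) - x).
have q0 : (0 < p ^ d)%N by rewrite expn_gt0 prime_gt0.
have DD x y : D x -> D y -> D (x + y).
  move=> [Ox Lx] [Oy Ly]; split; first exact: ringOD.
  apply: subgroup_trans (frobeniusD d Ox Oy) _ => //.
  by rewrite opprD addrACA; apply: subgroupD.
have Dp y : O y -> D (p%:R * y).
  have [_ _ _ LM] := iL => Oy.
  have Opy : O (p%:R * y) by apply: ringOM => //; apply: ringO_nat.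
  have Lpy : L (p%:R * y) by rewrite mulrC; apply: LM.
  split=> //; apply: OmoduleB => //; rewrite -(prednK q0) exprSr; apply: LM => //.
  exact: ringOX.
have D0 : D 0 by rewrite -(mulr0 p%:R); apply/Dp/ringO0.
have Dnat x k : D x -> D (x *+ k).
  by move=> Dx; elim: k => // k IHk; rewrite mulrS; apply: DD.
have DN x : D x -> D (- x).
  move=> Dx; have -> : - x = x *+ p.-1 + p%:R * (- x).
    rewrite mulrN mulr_natl -{2}(prednK (prime_gt0 hp)) mulrSr opprD addrA subrr.
    by rewrite sub0r.
  by apply: DD; [exact: Dnat | apply/Dp/ringON/Dx.1].
have Dint x z : D x -> D (x *~ z).
  by case: z => k Dx; [exact: Dnat | rewrite NegzE mulrNz; apply/DN/Dnat].
move=> x Ox; have [c [-> _]] := bP x Ox.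
suff [] : D (\sum_i b i *~ c i) by [].
by elim/big_ind: _ => // i _; apply: Dint.
Qed.

End Frobenius.

Section Content.
Variables (K : fieldExtType rat) (n p : nat) (xi : 'I_n -> K).
Notation O := (ringO K).
Hypothesis Oxi : forall i, O (xi i).

(** The content of w_d - w_0, in the form in which it enters divisorF. *)
Definition wdiff_content d : set K :=
  let w := wform p (fun i => 'X_i) (fun i => (xi i)%:MP : {mpoly K[n]}) in
  content_ideal (w d - w 0%N).

Lemma mcoeff_wdiff d m :
  (wform p (fun i => 'X_i) (fun i => (xi i)%:MP : {mpoly K[n]}) d -
   wform p (fun i => 'X_i) (fun i => (xi i)%:MP : {mpoly K[n]}) 0)@_m =
  \sum_(i < n) (U_(i)%MM == m)%:R * (xi i ^+ (p ^ d) - xi i).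
Proof.
rewrite /wform -sumrB raddf_sum /=; apply: eq_bigr => i _.
by rewrite -mulrBr expn0 expr1 -rmorphXn -rmorphB /= mulrC mcoeffCM mcoeffX mulrC.
Qed.

Lemma ideal_wdiff_content d : is_ideal (wdiff_content d).
Proof.
have [O0 OD OM] := Omodule_idealM (range (fun m => 
  (wform p (fun i => 'X_i) (fun i => (xi i)%:MP : {mpoly K[n]}) d -
   wform p (fun i => 'X_i) (fun i => (xi i)%:MP : {mpoly K[n]}) 0)@_m)) (Omodule_ringO K).
split=> //; apply: idealM_sub; [exact: ringO0 | exact: ringOD | move=> a _ Oa [m _ <-]].
apply: ringOM => //; rewrite mcoeff_wdiff; apply: ringO_sum => i _.
by apply: ringOM; [exact: ringO_nat | apply: ringOB => //; apply: ringOX].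
Qed.

Lemma wdiff_content_mem d i : wdiff_content d (xi i ^+ (p ^ d) - xi i).
Proof.
rewrite -[X in wdiff_content d X]mul1r; apply: mem_idealM; first exact: ringO1.
exists U_(i)%MM => //; rewrite mcoeff_wdiff (bigD1 i) //= eqxx mul1r big1 ?addr0 // => j nji.
by rewrite eq_mnm1 (negbTE nji) mul0r.
Qed.

Lemma wdiff_content_sub d J : is_ideal J -> (forall i, J (xi i ^+ (p ^ d) - xi i)) ->
  wdiff_content d `<=` J.
Proof.
move=> [JO J0 JD JM] Jxi; apply: idealM_sub => // a _ Oa [m _ <-].
apply: (JM) => //; rewrite mcoeff_wdiff; elim/big_ind: _ => // i _.
by apply: JM => //; apply: ringO_nat.
Qed.

End Content.

(** * Moebius inversion *)
Lemma moebius_sq (q m : nat) : prime q -> (0 < m)%N -> (q ^ 2 %| m)%N -> moebius m = 0.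
Proof.
move=> hq m0 qm; rewrite /moebius ifT //; apply/hasP; exists q.
  by rewrite mem_primes hq m0 (dvdn_trans _ qm) // dvdn_exp.
by rewrite -pfactor_dvdn.
Qed.

Lemma moebiusM_prime (q m : nat) : prime q -> (0 < m)%N -> ~~ (q %| m)%N ->
  moebius (q * m) = - moebius m.
Proof.
move=> hq m0 nqm; have q0 := prime_gt0 hq.
have nq : q \notin primes m by rewrite mem_primes hq m0.
have pqm : perm_eq (primes (q * m)) (q :: primes m).
  apply: uniq_perm; rewrite ?primes_uniq //= ?nq ?primes_uniq // => r.
  by rewrite primesM // primes_prime // !inE.
have has_eq : has (fun r => 1 < logn r (q * m))%N (primes (q * m)) =
              has (fun r => 1 < logn r m)%N (primes m).
  rewrite (perm_has _ pqm) /= lognM // logn_prime // eqxx.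
  have -> : logn q m = 0%N by apply/eqP; rewrite lognE hq m0 (negbTE nqm).
  apply: eq_in_has => r rm; rewrite lognM // logn_prime // (negbTE (_ : r != q)) //.
  by apply: contra nq => /eqP <-.
rewrite /moebius has_eq (perm_size pqm) /= exprS mulN1r.
by case: ifP; rewrite ?oppr0.
Qed.

(** For a prime q dividing m, the divisors e prime to q cancel against the
    q e, and the divisors that are multiples of q ^ 2 contribute 0. *)
Lemma sum_moebius (m : nat) : (0 < m)%N ->
  \sum_(e <- divisors m) moebius e = (m == 1)%N%:R.
Proof.
move=> m0; have [->|m1] := eqVneq m 1%N; first by rewrite big_seq1.
have {m1}m1 : (1 < m)%N by case: m m0 m1 => [|[]].
pose q := pdiv m; have hq : prime q := pdiv_prime m1; have qm : (q %| m)%N := pdiv_dvd m.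
have dvd0 e : (e \in divisors m) -> (0 < e)%N.
  by rewrite -dvdn_divisors // => /dvdn_gt0; apply.
rewrite (bigID (fun e => q %| e)%N) /= (bigID (fun e => q ^ 2 %| e)%N) /=.
rewrite [X in X + _ + _]big_seq_cond [X in X + _ + _]big1 ?add0r; last first.
  by move=> e /and3P[em _ qe]; apply: (moebius_sq hq) => //; apply: dvd0.
rewrite -[X in X + _]big_filter -[X in _ + X]big_filter.
set s := filter _ _; set t := filter _ _.
have st : perm_eq s [seq (q * e)%N | e <- t].
  apply: uniq_perm => [||e]; first by rewrite filter_uniq ?divisors_uniq.
    rewrite map_inj_uniq ?filter_uniq ?divisors_uniq // => x y /eqP.
    by rewrite eqn_pmul2l ?prime_gt0 // => /eqP.
  rewrite mem_filter -dvdn_divisors //; apply/idP/mapP => [/andP[/andP[qe nqe] em]|[e' + ->]].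
    have [e' ee] := dvdnP qe; exists e'; last by rewrite mulnC.
    rewrite mem_filter -dvdn_divisors //; apply/andP; split; last first.
      by apply: dvdn_trans em; rewrite ee dvdn_mulr.
    by apply: contra nqe => qe'; rewrite ee expnS expn1 dvdn_mul.
  rewrite mem_filter -dvdn_divisors // => /andP[nqe em].
  rewrite dvdn_mulr //= expnS expn1 dvdn_pmul2l ?prime_gt0 // nqe /=.
  by rewrite Gauss_dvd ?qm // prime_coprime.
rewrite (perm_big _ st) big_map big_seq [X in _ + X]big_seq -big_split big1 // => e /=.
rewrite mem_filter => /andP[nqe em].
by rewrite moebiusM_prime ?addNr //; apply: dvd0.
Qed.

(** The divisors d of kappa that are multiples of f are the kappa / e with e
    dividing kappa / f. *)
Lemma sum_eps (kappa f : nat) : (0 < kappa)%N ->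
  \sum_(d <- divisors kappa | (f %| d)%N) eps kappa d = (f == kappa)%:R.
Proof.
move=> k0; have divKn e : (e %| kappa)%N -> (kappa %/ (kappa %/ e) = e)%N.
  by move=> ek; rewrite divnA // mulKn.
have [fk|nfk] := boolP (f %| kappa)%N; last first.
  rewrite big_seq_cond big1 => [|d]; first by case: eqP nfk => // ->; rewrite dvdnn.
  by rewrite -dvdn_divisors // => /andP[dk fd]; rewrite (dvdn_trans fd dk) in nfk.
have f0 : (0 < f)%N := dvdn_gt0 k0 fk.
have kf0 : (0 < kappa %/ f)%N by rewrite divn_gt0 // dvdn_leq.
have dk :
    perm_eq [seq d <- divisors kappa | (f %| d)%N]
      [seq (kappa %/ e)%N | e <- divisors (kappa %/ f)].
  have sub e : (e %| kappa %/ f)%N -> (e %| kappa)%N.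
    by move=> ek; apply: dvdn_trans ek _; apply: dvdn_div.
  apply: uniq_perm => [||d]; first by rewrite filter_uniq ?divisors_uniq.
    rewrite map_inj_in_uniq ?divisors_uniq // => x y.
    rewrite -!dvdn_divisors // => /sub xk /sub yk exy.
    by rewrite -(divKn x) // exy divKn.
  rewrite mem_filter -dvdn_divisors //; apply/andP/mapP => [[fd dk]|[e]].
    exists (kappa %/ d)%N; last by rewrite divKn.
    rewrite -dvdn_divisors // -(@dvdn_pmul2r f) // divnK //.
    by rewrite -{2}(divnK dk) dvdn_pmul2l ?divn_gt0 ?(dvdn_gt0 k0 dk) // dvdn_leq.
  rewrite -dvdn_divisors // => ek ->; split; last exact/dvdn_div/sub.
  rewrite -(@dvdn_pmul2r e) ?(dvdn_gt0 kf0 ek) // divnK; last exact: sub.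
  by rewrite -{1}(divnK fk) mulnC dvdn_pmul2r.
rewrite -big_filter (perm_big _ dk) big_map (eq_big_seq moebius); last first.
  move=> e; rewrite -dvdn_divisors // => ek; rewrite /eps divKn //.
  by apply: dvdn_trans ek _; apply: dvdn_div.
rewrite sum_moebius //; congr (nat_of_bool _)%:R.
by rewrite -(eqn_pmul2r f0) divnK // mul1n eq_sym.
Qed.

(** * Units at p *)
(** The fraction need not be reduced, so that products are immediate. *)
Definition p_frac (p : nat) (r : rat) :=
  exists a b : nat, [/\ coprime p a, coprime p b & r = a%:R / b%:R].

Lemma p_frac_unit p r : prime p -> p_frac p r -> p_unit p r.
Proof.
move=> hp [a [b [pa pb er]]].
have b0 : b%:R != 0 :> rat.
  by rewrite pnatr_eq0; apply: contraL pb => /eqP->; rewrite /coprime gcdn0 gtn_eqF ?prime_gt1.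
have eZ : numq r * b%:Z = a%:Z * denq r.
  apply: (@intr_inj rat); rewrite !rmorphM /= -!pmulrn.
  have d0 : (denq r)%:~R != 0 :> rat by rewrite intr_eq0 denq_neq0.
  by apply: (mulIf (invr_neq0 d0)); rewrite mulfK // mulrAC divq_num_den er divfK.
have eN : (`|numq r| * b = a * `|denq r|)%N.
  by have /(congr1 absz) := eZ; rewrite !abszM !absz_nat.
have cnd := coprime_num_den r; apply/andP; split.
  apply: coprime_dvdr pa; rewrite -(Gauss_dvdl _ cnd) -eN; exact: dvdn_mulr.
apply: coprime_dvdr pb; rewrite -(@Gauss_dvdr _ `|numq r|) 1?coprime_sym // eN.
exact: dvdn_mull.
Qed.

Lemma p_fracM p r s : p_frac p r -> p_frac p s -> p_frac p (r * s).
Proof.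
move=> [a [b [pa pb ->]]] [c [d [pc pd ->]]]; exists (a * c)%N, (b * d)%N.
by rewrite !coprimeMr pa pb pc pd !natrM mulf_div.
Qed.

Lemma p_frac_nat p m : coprime p m -> p_frac p m%:R.
Proof. by move=> pm; exists m, 1%N; rewrite coprimen1 divr1. Qed.

Lemma p_fracV p r : p_frac p r -> p_frac p r^-1.
Proof. by move=> [a [b [pa pb ->]]]; exists b, a; rewrite invf_div. Qed.

Lemma p_fracX p r (z : int) : p_frac p r -> p_frac p (r ^ z).
Proof.
have pX (s : rat) k : p_frac p s -> p_frac p (s ^+ k).
  move=> ps; elim: k => [|k IHk]; first exact: p_frac_nat (coprimen1 p).
  by rewrite exprS; apply: p_fracM.
case: z => k pr; first exact: pX.
by rewrite NegzE -exprnN; apply/p_fracV/pX.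
Qed.

(** * The norm of the divisor *)
Section DivisorNorm.
Variables (K : fieldExtType rat) (n p : nat) (xi : 'I_n.+1 -> K).
Hypotheses (hp : prime p)
  (hb : integral_basis (fun i => if i == ord0 then 1 else xi i))
  (hxi1 : xi ord0 = 1 + p%:R).
Notation O := (ringO K).
Notation N := (quo_index O).
Notation primes_p := (fset_set (@primes_over K p)).
Let finO := finite_index_multiples hb.

(** The residual degree of a prime P over p, read off its norm p ^ f. *)
Definition degree P := logn p (N P).

Lemma mem_primes_over P : P \in primes_p -> prime_ideal P /\ P p%:R.
Proof. by rewrite in_fset_set ?inE //; exact: finite_primes_over hb hp. Qed.

Lemma norm_prime_over P : prime_ideal P -> P p%:R -> N P = (p ^ degree P)%N.
Proof.
move=> [iP _ _] Pp; have [k degP] := residual_degree_exists hb hp iP Pp.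
by rewrite /degree (residual_degree_norm hp iP degP) pfactorK.
Qed.

Lemma ringO_xi i : O (xi i).
Proof.
case: hb => Ob _; have := Ob i; case: eqP => [->|//] _.
by rewrite hxi1; apply: ringOD; [exact: ringO1 | exact: ringO_nat].
Qed.

(** The norm of L = I + p O is computed first, since x ^ (p ^ d) = x in O / L.
    The index of I in L is prime to p: since xi_1 = 1 + p, the element
    xi_1 ^ (p ^ d) - xi_1 of I is p m with m prime to p, hence m L is
    contained in I, and the index of m L in L is m ^ (n + 1). *)
Lemma norm_wdiff_content d : (0 < d)%N ->
  nzideal (wdiff_content p xi d) /\ exists2 m, coprime p m &
    N (wdiff_content p xi d) =
      (p ^ (\sum_(P <- primes_p | degree P %| d) degree P) * m)%N.
Proof.
move=> d0; set I := wdiff_content p xi d.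
have iI : is_ideal I := ideal_wdiff_content p ringO_xi d.
have Ixi i : I (xi i ^+ (p ^ d) - xi i) := wdiff_content_mem p xi d i.
have [m pm eq_pm] := expn_succ_sub hp d0.
have m0 : (0 < m)%N.
  by rewrite lt0n; apply: contraL pm => /eqP->; rewrite /coprime gcdn0 gtn_eqF ?prime_gt1.
have Ipm : I (p * m)%:R.
  have := Ixi ord0; by rewrite hxi1 nat1r -natrX eq_pm natrD addrC addKr.
have nI : nzideal I by split=> //; exists (p * m)%N => //; rewrite muln_gt0 m0 prime_gt0.
split=> //.
have [IO I0 ID IM] := iI; have mI := Omodule_ideal iI.
pose L := [set x | exists2 y, O y & I (x - p%:R * y)].
have IL : I `<=` L by move=> x Ix; exists 0; [exact: ringO0 | rewrite mulr0 subr0].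
have Lp : L p%:R by exists 1; [exact: ringO1 | rewrite mulr1 subrr].
have iL : is_ideal L.
  split=> [x [y Oy /IO Oxy]||x x' [y Oy Iy] [y' Oy' Iy']|a x Oa [y Oy Iy]].
  - rewrite -(subrK (p%:R * y) x); apply: ringOD => //; apply: ringOM => //; exact: ringO_nat.
  - exact: IL.
  - by exists (y + y'); [exact: ringOD | rewrite mulrDr opprD addrACA; apply: ID].
  - by exists (a * y); [exact: ringOM | rewrite mulrCA -mulrBr; apply: IM].
have nL := nzideal_over hp iL Lp; have mL := Omodule_ideal iL.
have nM : nzideal (@multiples K m) := nzideal_multiples K m0.
have q1 : (1 < p ^ d)%N by rewrite -(expn0 p) ltn_exp2l ?prime_gt1.
have Lq x : O x -> L (x ^+ (p ^ d) - x).
  apply: (frobenius_fixes hp iL Lp hb) => i; case: eqP => [_|_]; last exact/IL/Ixi.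
  by rewrite expr1n subrr; case: iL.
have subL P : prime_ideal P -> P p%:R -> `[< L `<=` P >] = (degree P %| d)%N.
  move=> pP Pp; have [iP _ _] := pP; have [PO _ PD _] := iP.
  have frobP := frobenius_fixes_mod_prime hb hp d pP Pp (norm_prime_over pP Pp).
  apply/asboolP/idP => [LP|/frobP Pq]; first by apply/frobP => x Ox; apply/LP/Lq.
  have IP : I `<=` P by apply: wdiff_content_sub => // i; apply/Pq/ringO_xi.
  move=> x [y Oy /IP Pxy]; rewrite -(subrK (p%:R * y) x); apply: PD => //.
  by apply: OmoduleMr => //; exact: Omodule_ideal.
have NL : N L = (p ^ (\sum_(P <- primes_p | degree P %| d) degree P))%N.
  rewrite (norm_radical hb hp iL Lp q1 Lq) expn_sum big_seq_cond [RHS]big_seq_cond.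
  apply: eq_big => [P|P /andP[/mem_primes_over[pP Pp] _]]; last exact: norm_prime_over.
  by have [/mem_primes_over[pP Pp]|//] := boolP (P \in _); rewrite subL.
have [sO sL sI] := And3 (Omodule_subgroup (Omodule_ringO K)) (Omodule_subgroup mL)
  (Omodule_subgroup mI).
have LO : L `<=` O by case: iL.
have finI := nzideal_finite_index finO nI; have finL := nzideal_finite_index finO nL.
have finLI : finite_index L I by apply: finite_indexS finI.
exists (quo_index L I); last first.
  by have [_ ->] := quo_index_tower sO sL sI IL LO finL finLI; rewrite NL.
have LmI : idealM L (multiples m) `<=` I.
  apply: idealM_sub => // x _ [y Oy Ixy] [z Oz <-].
  rewrite (_ : x * _ = (m%:R * z) * (x - p%:R * y) + (y * z) * (p * m)%:R); last first.
    by rewrite natrM; ring.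
  have Om : O m%:R by apply: ringO_nat.
  by apply: ID; apply: IM => //; apply: ringOM.
have iLi := nzideal_invertibleW finO nL.
have [finLm] := quo_index_mul finO iLi nM; rewrite (quo_index_multiples hb m0) => eqLm.
have mLm := Omodule_idealM (multiples m) mL; have sLm := Omodule_subgroup mLm.
have finIm : finite_index I (idealM L (multiples m)) by apply: finite_indexS finLm.
have [_ eLI] := quo_index_tower sL sI sLm LmI IL finLI finIm.
apply: (@coprime_dvdr _ (m ^ n.+1)); last exact: coprimeXr.
by rewrite -eqLm eLI dvdn_mulr.
Qed.

Lemma prime_factors_of_degreeP kappa P :
  prime_factors_of_degree K p kappa P <-> P \in primes_p /\ degree P = kappa.
Proof.
rewrite in_fset_set; last exact: finite_primes_over hb hp.
rewrite inE; split=> [[/(prime_factorP hb hp)[pP Pp] degP]|[[pP Pp] <-]].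
  have [iP _ _] := pP; split=> //.
  by rewrite /degree (residual_degree_norm hp iP degP) pfactorK.
split; first by apply/(prime_factorP hb hp).
have [iP _ _] := pP; apply/(residual_degreeP hb hp) => //.
exact: norm_prime_over.
Qed.

Lemma finite_prime_factors_of_degree kappa :
  finite_set (prime_factors_of_degree K p kappa).
Proof.
apply: sub_finite_set (finite_primes_over hb hp) => P.
by move=> /prime_factors_of_degreeP[/mem_primes_over].
Qed.

Lemma lambdaE kappa : lambda K p kappa = count (fun P => degree P == kappa) primes_p.
Proof.
rewrite /lambda -size_filter; apply/perm_size/uniq_perm.
- exact: fset_uniq.
- exact/filter_uniq/fset_uniq.
move=> P; rewrite mem_filter in_fset_set; last exact: finite_prime_factors_of_degree.
apply/idP/andP => [/set_mem/prime_factors_of_degreeP[-> /eqP]//|[/eqP degP Pp]].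
exact/mem_set/prime_factors_of_degreeP.
Qed.

(** Each prime over p of degree f contributes f times the sum of eps_d over the
    d with f | d | kappa, which vanishes unless f = kappa. *)
Lemma sum_degrees (kappa : nat) : (0 < kappa)%N ->
  \sum_(d <- divisors kappa)
     eps kappa d * (\sum_(P <- primes_p | degree P %| d) degree P)%N%:Z
  = (kappa * lambda K p kappa)%N.
Proof.
move=> k0.
under eq_bigr do rewrite (big_morph Posz PoszD (erefl _)) big_mkcond mulr_sumr /=.
rewrite exchange_big /= (eq_bigr (fun P => if degree P == kappa then kappa%:Z else 0)).
  by rewrite -big_mkcond big_const_seq iter_addr_0 lambdaE -mulr_natr natz -PoszM.
move=> P _; transitivity ((degree P)%:Z * (degree P == kappa)%:R).
  rewrite -(sum_eps _ k0) mulr_sumr [RHS]big_mkcond; apply: eq_bigr => d _ /=.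
  by case: ifP => _; rewrite ?mulr0 // mulrC.
by case: eqP => [->|_]; rewrite ?mulr1 ?mulr0.
Qed.

Lemma ideal_norm_divisorF (kappa : nat) : (0 < kappa)%N ->
  exists r : rat, p_unit p r /\
    ideal_norm (divisorF p xi kappa) = p%:R ^+ (kappa * lambda K p kappa) * r.
Proof.
move=> k0.
have dvd0 d : d \in divisors kappa -> (0 < d)%N.
  by rewrite -dvdn_divisors // => /dvdn_gt0; apply.
have p0 : p%:R != 0 :> rat by rewrite pnatr_eq0 -lt0n prime_gt0.
pose e d := (\sum_(P <- primes_p | degree P %| d) degree P)%N.
have /choice[m mP] d : exists m, d \in divisors kappa ->
    coprime p m /\ N (wdiff_content p xi d) = (p ^ e d * m)%N.
  have [/dvd0 d0|nd] := boolP (d \in divisors kappa); last by exists 0.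
  by have [_ [m pm Nm]] := norm_wdiff_content d0; exists m.
exists (\prod_(d <- divisors kappa) (m d)%:R ^ eps kappa d); split.
  apply: p_frac_unit => //; rewrite big_seq; elim/big_ind: _ => [|r s|d dk].
  - exact: p_frac_nat (coprimen1 p).
  - exact: p_fracM.
  - by apply/p_fracX/p_frac_nat; case: (mP d dk).
have /(has_normE finO) -> : has_norm (divisorF p xi kappa)
    (\prod_(d <- divisors kappa) (N (wdiff_content p xi d))%:R ^ eps kappa d).
  apply: has_norm_big => // d /dvd0 d0; apply: has_norm_idealX => //.
  exact: (norm_wdiff_content d0).1.
transitivity (\prod_(d <- divisors kappa)
    (p%:R ^ (eps kappa d * (e d)%:Z) * (m d)%:R ^ eps kappa d) : rat).
  apply: eq_big_seq => d /mP[_ ->].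
  by rewrite natrM natrX exprnP expfzMl exprz_exp [_%:Z * _]mulrC.
rewrite big_split /=; congr (_ * _).
rewrite exprnP -sum_degrees //.
by rewrite (big_morph _ (fun x y => expfzDr x y p0) (expr0z _)).
Qed.

End DivisorNorm.

(** * The degree of rational functions *)
Section RationalDegree.
Variables (A : idomainType) (n : nat).
Implicit Types (a b : {mpoly A[n]}) (f g : {fraction {mpoly A[n]}}).
Notation tofrac := (@FracField.tofrac {mpoly A[n]}).

Lemma frac_numdenE (R : idomainType) (f : {fraction R}) :
  f * FracField.tofrac \d_(repr f) = FracField.tofrac \n_(repr f).
Proof.
rewrite -{1}[f]reprK; set r := repr f.
rewrite -[_ * _]/(FracField.mul _ _) !piE; apply/eqmodP.
rewrite /= FracField.equivfE /FracField.mulf.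
by rewrite !numden_Ratio ?(oner_neq0, mulf_neq0, denom_ratioP) // !mulr1 mulrC.
Qed.

(** ratdeg reads the degree on one representative, has_ratdeg on any: both agree
    because sizes add, up to 1, in products of polynomials. *)
Definition has_ratdeg f (k : int) := exists a b,
  [/\ a != 0, b != 0, f = tofrac a / tofrac b & k = (msize a)%:Z - (msize b)%:Z].

Lemma has_ratdegE f k : has_ratdeg f k -> ratdeg f = k.
Proof.
move=> [a [b [a0 b0 ef ->]]]; have := frac_numdenE f; rewrite /ratdeg.
set d := \d_(repr f); set m := \n_(repr f) => em.
have d0 : d != 0 := denom_ratioP _.
have e : a * d = m * b.
  apply/eqP; rewrite -tofrac_eq !tofracM -em ef mulrAC divfK ?tofrac_eq0 //.
have m0 : m != 0.
  by apply: contra_neq (mulf_neq0 a0 d0); rewrite e => ->; rewrite mul0r.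
have := congr1 (fun q : {mpoly A[n]} => msize q) e; rewrite !msizeM //.
have pos (q : {mpoly A[n]}) : q != 0 -> (0 < msize q)%N by rewrite lt0n mmeasure_poly_eq0.
move: (pos a a0) (pos b b0) (pos d d0) (pos m m0).
move: (msize a) (msize b) (msize d) (msize m) => i j r s; lia.
Qed.

Lemma has_ratdeg_tofrac a : a != 0 -> has_ratdeg (tofrac a) ((msize a)%:Z - 1).
Proof. by move=> a0; exists a, 1; rewrite tofrac1 divr1 oner_neq0 msize1. Qed.

Lemma has_ratdeg1 : has_ratdeg 1 0.
Proof. by have := has_ratdeg_tofrac (oner_neq0 _); rewrite tofrac1 msize1 subrr. Qed.

Lemma has_ratdegM f g k l : has_ratdeg f k -> has_ratdeg g l -> has_ratdeg (f * g) (k + l).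
Proof.
move=> [a [b [a0 b0 -> ->]]] [c [d [c0 d0 -> ->]]]; exists (a * c), (b * d).
rewrite !mulf_neq0 // !tofracM mulf_div !msizeM //; split=> //.
have pos (q : {mpoly A[n]}) : q != 0 -> (0 < msize q)%N by rewrite lt0n mmeasure_poly_eq0.
move: (pos a a0) (pos b b0) (pos d d0) (pos c c0).
move: (msize a) (msize b) (msize d) (msize c) => i j r s; lia.
Qed.

Lemma has_ratdegV f k : has_ratdeg f k -> has_ratdeg f^-1 (- k).
Proof. by move=> [a [b [a0 b0 -> ->]]]; exists b, a; rewrite invf_div opprB. Qed.

Lemma has_ratdegX f k (z : int) : has_ratdeg f k -> has_ratdeg (f ^ z) (z * k).
Proof.
have X (g : {fraction {mpoly A[n]}}) l m : has_ratdeg g l -> has_ratdeg (g ^+ m) (m%:Z * l).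
  move=> gl; elim: m => [|m IHm]; first by rewrite mul0r; apply: has_ratdeg1.
  by rewrite exprS -add1n PoszD mulrDl mul1r; apply: has_ratdegM.
case: z => m fk; first exact: X.
by rewrite NegzE -exprnN mulNr; apply/has_ratdegV/X.
Qed.

Lemma msize_wdiff (p d : nat) (u : 'I_n -> A) (i0 : 'I_n) :
    prime p -> (0 < d)%N -> u i0 != 0 ->
  let w := wform p (fun i => (u i)%:MP) (fun i => 'X_i : {mpoly A[n]}) in
  msize (w d - w 0%N) = (p ^ d).+1.
Proof.
move=> hp d0 ui0 /=; set w := _ - _.
have q1 : (1 < p ^ d)%N by rewrite -(expn0 p) ltn_exp2l ?prime_gt1.
have ew : w = \sum_(i < n) u i *: ('X_[U_(i) *+ (p ^ d)] - 'X_i).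
  rewrite /w /wform -sumrB; apply: eq_bigr => i _.
  by rewrite -mulrBr expn0 expr1 mul_mpolyC mpolyXn.
apply/eqP; rewrite eqn_leq; apply/andP; split.
  rewrite ew; apply: leq_trans (mmeasure_sum _ _ _ _) _; apply/bigmax_leqP => i _.
  apply: leq_trans (msizeZ_le _ _) _; apply: leq_trans (mmeasureD_le _ _ _) _.
  by rewrite mmeasureN !msizeX mdegMn !mdeg1 mul1n geq_max leqnn ltnW.
suff : (U_(i0) *+ (p ^ d))%MM \in msupp w.
  by move/msize_mdeg_lt; rewrite mdegMn mdeg1 mul1n.
have neqX i : (U_(i) == U_(i0) *+ (p ^ d))%MM = false.
  apply/eqP => /(congr1 mdeg); rewrite mdegMn !mdeg1 mul1n => eq1.
  by rewrite -eq1 in q1.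
rewrite mcoeff_msupp ew raddf_sum /= (bigD1 i0) //= big1 => [|i ni].
  by rewrite addr0 mcoeffZ mcoeffB !mcoeffX eqxx neqX subr0 mulr1.
rewrite mcoeffZ mcoeffB !mcoeffX neqX subr0 (_ : (_ == _) = false) ?mulr0 //.
apply/eqP => /mnmP/(_ i); rewrite !mulmnE !mnm1E eqxx eq_sym (negbTE ni) mul1n => eq0.
by rewrite eq0 in q1.
Qed.

End RationalDegree.

Lemma ratdeg_symbolicF (n p kappa : nat) : prime p -> (0 < kappa)%N ->
  ratdeg (symbolicF n.+1 p kappa) = gdim p kappa.
Proof.
move=> hp k0; apply: has_ratdegE; rewrite /symbolicF /Fform /gdim.
rewrite big_seq [X in has_ratdeg _ X]big_seq.
elim/big_rec2: _ => [|d k f dk fk]; first exact: has_ratdeg1.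
apply: has_ratdegM => //; apply: has_ratdegX.
have d0 : (0 < d)%N by move: dk; rewrite -dvdn_divisors // => /dvdn_gt0; apply.
have u0 : ('X_ord0 : {mpoly int[n.+1]}) != 0 by rewrite -msize_poly_eq0 msizeX.
pose w := wform p (fun i : 'I_n.+1 => ('X_i : {mpoly int[n.+1]})%:MP)
  (fun i => 'X_i : {mpoly {mpoly int[n.+1]}[n.+1]}).
have size_w : msize (w d - w 0%N) = (p ^ d).+1 := msize_wdiff hp d0 u0.
have w0 : w d - w 0%N != 0 by rewrite -msize_poly_eq0 size_w.
by have := has_ratdeg_tofrac w0; rewrite size_w -(addn1 (p ^ d)) PoszD addrK.
Qed.

Theorem mainTheorem7 (K : fieldExtType rat) (n : nat)
  (hn : \dim (fullv : {vspace K}) = n.+1)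
  (p : nat) (hp : prime p)
  (xi : 'I_n.+1 -> K)
  (hbasis : integral_basis (fun i => if i == ord0 then 1 else xi i))
  (hxi1 : xi ord0 = 1 + p%:R)
  (kappa : nat) (hkappa : (0 < kappa)%N) :
  [/\ ratdeg (symbolicF n.+1 p kappa) = gdim p kappa,
      finite_set (prime_factors_of_degree K p kappa),
      exists r : rat, p_unit p r /\
        ideal_norm (divisorF p xi kappa)
          = p%:R ^+ (kappa * lambda K p kappa) * r
    & (~ exists P : set K, prime_factor p P /\ residual_degree p P kappa) ->
      lambda K p kappa = 0%N].
Proof.
split.
- exact: ratdeg_symbolicF.
- exact: (finite_prime_factors_of_degree hp hbasis).
- exact: ideal_norm_divisorF.
- move=> noP; rewrite /lambda (_ : prime_factors_of_degree K p kappa = set0).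
    by rewrite fset_set0 cardfs0.
  by apply/seteqP; split=> // P degP; case: noP; exists P.
Qed.
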